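(* PARTITION-BY-ORIENTATION is NP-complete.
   Context: PARTITION-BY-ORIENTATION is the decision problem: given a finite bipartite graph $G=(\mathcal{B},\mathcal{C};\mathcal{E})$ with $\deg(c)\le 4$ for all $c\in\mathcal{C}$, decide whether $\mathcal{B}$ can be partitioned into two disjoint sets $\mathcal{B}_H$ and $\mathcal{B}_V$ such that every $c\in\mathcal{C}$ is adjacent to at most two vertices of $\mathcal{B}_H$ and at most two vertices of $\mathcal{B}_V$. *)

(* Defs.v *)
From mathcomp Require Import all_boot.

Set Implicit Arguments.
Unset Strict Implicit.
Unset Printing Implicit Defensive.

(* tape symbols: [Some b] is the bit b, [None] is the blank *)
Definition sym := option bool.

Inductive move := MoveL | MoveR | Stay.

(* A deterministic TM with the finite state set 'I_Q.+1, start state ord0.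
   [delta q a = None] means that the machine halts in state q reading a. *)
Record TM := {
  tm_Q : nat;
  tm_delta : 'I_tm_Q.+1 -> sym -> option ('I_tm_Q.+1 * sym * move)
}.

(* configuration: state, reversed left part of the tape, scanned symbol,
   right part of the tape (all unlisted cells are blank) *)
Record config (M : TM) := Config {
  cf_state : 'I_(tm_Q M).+1;
  cf_left : seq sym;
  cf_cur : sym;
  cf_right : seq sym
}.

Definition do_move (l : seq sym) (a : sym) (r : seq sym) (m : move)
  : seq sym * sym * seq sym :=
  match m with
  | Stay => (l, a, r)
  | MoveL => match l with
             | [::] => ([::], None, a :: r)
             | x :: l' => (l', x, a :: r)
             end
  | MoveR => match r with
             | [::] => (a :: l, None, [::])
             | x :: r' => (a :: l, x, r')
             end
  end.

Definition step (M : TM) (c : config M) : option (config M) :=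
  match tm_delta (cf_state c) (cf_cur c) with
  | None => None
  | Some (q', a', m) =>
      let: (l', x, r') := do_move (cf_left c) a' (cf_right c) m in
      Some (Config q' l' x r')
  end.

Fixpoint exec (M : TM) (t : nat) (c : config M) : config M :=
  match t with
  | 0 => c
  | t'.+1 => match step c with
             | None => c
             | Some c' => exec t' c'
             end
  end.

Definition halted (M : TM) (c : config M) : bool :=
  if step c is None then true else false.

Definition init (M : TM) (x : seq bool) : config M :=
  match x with
  | [::] => Config (ord0 : 'I_(tm_Q M).+1) [::] None [::]
  | b :: x' => Config (ord0 : 'I_(tm_Q M).+1) [::] (Some b) (map Some x')
  end.

Fixpoint bits_prefix (s : seq sym) : seq bool :=
  match s with
  | Some b :: s' => b :: bits_prefix s'
  | _ => [::]
  end.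

Definition output (M : TM) (c : config M) : seq bool :=
  bits_prefix (cf_cur c :: cf_right c).

Definition computes_in (M : TM) (f : seq bool -> seq bool)
    (T : nat -> nat) : Prop :=
  forall x, exists t, t <= T (size x) /\
    halted (exec t (init M x)) /\ output (exec t (init M x)) = f x.

Definition polybound (k : nat) : nat -> nat := fun n => k * n ^ k + k.

Definition poly_time_computable (f : seq bool -> seq bool) : Prop :=
  exists (M : TM) (k : nat), computes_in M f (polybound k).

Definition language := seq bool -> Prop.

Definition poly_time_decidable (L : language) : Prop :=
  exists f, poly_time_computable f /\
    forall x, (L x -> f x = [:: true]) /\ (~ L x -> f x = [:: false]).

Definition pair_enc (x w : seq bool) : seq bool :=
  flatten [seq [:: b; b] | b <- x] ++ [:: false; true] ++ w.

Definition in_NP (L : language) : Prop :=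
  exists (V : language) (k : nat), poly_time_decidable V /\
    forall x, L x <-> exists w, size w <= polybound k (size x) /\ V (pair_enc x w).

Definition poly_reduces (L1 L2 : language) : Prop :=
  exists f, poly_time_computable f /\ forall x, L1 x <-> L2 (f x).

Definition NP_hard (L : language) : Prop :=
  forall L' : language, in_NP L' -> poly_reduces L' L.

Definition NP_complete (L : language) : Prop := in_NP L /\ NP_hard L.

(* A finite bipartite graph G = (B, C; E) is given by finite types B, C and
   the adjacency E b c.  It is a yes-instance iff deg(c) <= 4 for every c
   and B splits into disjoint B_H, B_V covering B such that each c has at
   most two neighbours in B_H and at most two in B_V. *)
Definition PBO_yes (B C : finType) (E : B -> C -> bool) : Prop :=
  (forall c : C, #|[set b | E b c]| <= 4) /\
  exists BH BV : {set B},
    [/\ BH :&: BV = set0, BH :|: BV = setT &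
        forall c : C, #|[set b in BH | E b c]| <= 2 /\
                      #|[set b in BV | E b c]| <= 2].

Definition PBO_encode (n m : nat) (E : 'I_n -> 'I_m -> bool) : seq bool :=
  nseq n true ++ [:: false] ++ nseq m true ++ [:: false] ++
  flatten [seq [seq E b c | c <- enum 'I_m] | b <- enum 'I_n].

(* The language: encodings of yes-instances (strings that are not valid
   encodings, or encode graphs with some deg(c) > 4, are rejected). *)
Definition PARTITION_BY_ORIENTATION : language :=
  fun x => exists (n m : nat) (E : 'I_n -> 'I_m -> bool),
    x = PBO_encode E /\ PBO_yes E.

(* Main.v *)
(* Every function whose output bits are given by an arithmetic expression
   (sums, differences, bounded sums, input lookup) in the input and the output
   position is polynomial-time computable: such an expression takes
   polynomially bounded values, which are kept in unary on the stacks of a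
   machine that a one-tape Turing machine simulates, the stacks being
   interleaved on one side of its tape and input and output being on the other
   side.  Checking a given orientation is an expression of this kind.

   For hardness, a computation of the verifier on an unknown witness is
   described by implications A /\ B -> D between atoms "the head is at p in
   state q at time t" and "cell p holds s at time t", together with two binary
   disjunctions for each witness cell.  A model makes at least the atoms of an
   actual computation true, so no clause has to forbid false atoms.  Since the
   verifier is total, it suffices to forbid rejection.  With a vertex F
   regarded as false, A /\ B -> D amounts to "not all equal" on {A, B, n} and
   {n, D, F} for a new vertex n, and P \/ Q to the same on {P, Q, F}; a vertex
   c of degree three states precisely that its neighbours do not all lie in the
   same class. *)
Require Import Defs.
From HB Require Import structures.
From mathcomp Require Import all_boot ssralg ssrnum ssrint zify.
From Stdlib Require Import FunctionalExtensionality Classical.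

Set Implicit Arguments.
Unset Strict Implicit.
Unset Printing Implicit Defensive.
Import GRing.Theory Num.Theory.

(** Both the verifier and the reduction must be exhibited as one-tape machines. Arithmetic
    expressions are the language in which this stays feasible, and they shape the construction:
    vertices, rules and triples are numbers in mixed radix, decoded by division and remainder, and
    the rules form a full grid in which every index carries every field, whether or not its kind of
    rule looks at it.

    The halting time of the simulated verifier is unknown. A halted machine is therefore made to
    stand still, so that the scanned symbol can be inspected at one fixed late time. The origin of
    the tape is moved further to the right than the number of steps considered, so that positions
    are natural numbers and the head never meets a border.

    A vertex of degree three separates its neighbours only if they are three distinct vertices. This
    is why two vertices are forced to be true rather than one: a rule with a missing premise must
    still have two different ones. Complementing a labelling preserves all conditions, so it is no
    restriction to regard the class of [vF] as false. *)

Definition tape := int -> sym.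

Definition write (T : tape) (h : int) (a : sym) : tape :=
  fun z => if z == h then a else T z.

(** * Jumping machines *)

Definition cell (M : TM) (c : config M) (z : int) : sym :=
  match z with
  | Posz 0 => cf_cur c
  | Posz k.+1 => nth None (cf_right c) k
  | Negz k => nth None (cf_left c) k
  end.

Definition offset (m : move) : int :=
  match m with MoveL => Negz 0 | MoveR => Posz 1 | Stay => Posz 0 end.

Lemma exec_add (M : TM) (c : config M) t1 t2 :
  exec (t1 + t2) c = exec t2 (exec t1 c).
Proof.
elim: t1 c => [|t1 IH] c //=.
case E: (step c) => [c'|]; first exact: IH.
by case: t2 {IH} => //= t2; rewrite E.
Qed.

(** The relation speaks of cells only, so lists that differ in trailing blanks represent the same
    tape and never have to be compared. *)
Definition represents (M : TM) (c : config M) (T : tape) (h : int) : Prop :=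
  forall z, cell c z = T (h + z)%R.

Lemma step_represents (M : TM) (c : config M) T h q a m :
  represents c T h -> tm_delta (cf_state c) (T h) = Some (q, a, m) ->
  exists c', [/\ step c = Some c', cf_state c' = q &
    represents c' (write T h a) (h + offset m)%R].
Proof.
move=> rep dl; have cur: cf_cur c = T h.
  by have := rep 0%R; rewrite addr0.
rewrite /step cur dl.
have tac : forall c' : config M, cf_state c' = q ->
  (forall z, cell c' z = if (offset m + z == 0)%R then a else cell c (offset m + z)%R) ->
  cf_state c' = q /\ represents c' (write T h a) (h + offset m)%R.
  move=> c' eq_q eq_c; split=> // z; rewrite eq_c /write.
  case: eqP => [e0|ne0]; first by rewrite -addrA e0 addr0 eqxx.
  by rewrite rep addrA; case: eqP => // e; case: ne0; lia.
case E: (do_move (cf_left c) a (cf_right c) m) => [[l' x'] r'].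
exists (Config q l' x' r').
split=> //.
apply tac => // z; move: E.
case: m {dl tac} => /=.
- by case er: (cf_left c) => [|y r] [<- <- <-];
    case: z => [[|[|k]]|k] //=; rewrite ?er ?nth_nil.
- by case er: (cf_right c) => [|y r] [<- <- <-];
    case: z => [[|k]|[|k]] //=; rewrite ?er ?nth_nil ?subn1.
- by case=> <- <- <-; case: z => [[|k]|k] /=; rewrite ?add0n ?subn0.
Qed.

Lemma halted_represents (M : TM) (c : config M) T h :
  represents c T h -> tm_delta (cf_state c) (T h) = None -> step c = None.
Proof.
move=> rep dl; have cur: cf_cur c = T h.
  by have := rep 0%R; rewrite addr0.
by rewrite /step cur dl.
Qed.

Definition input_tape (x : seq bool) : tape :=
  fun z => match z with Posz k => nth None (map Some x) k | Negz _ => None end.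

Lemma init_represents (M : TM) x : represents (init M x) (input_tape x) 0%R.
Proof.
by move=> z; rewrite add0r; case: x => [|b x]; case: z => [[|k]|k] //=; rewrite nth_nil.
Qed.

Lemma output_represents (M : TM) (c : config M) T h (y : seq bool) :
  represents c T h ->
  (forall k, T (h + Posz k)%R = nth None (map Some y) k) ->
  output c = y.
Proof.
move=> rep HT; rewrite /output.
have: forall k, nth None (cf_cur c :: cf_right c) k = nth None (map Some y) k.
  by move=> k; rewrite -HT -rep; case: k.
elim: y (cf_cur c :: cf_right c) {HT} => [|b y IH] [|a l] //= H.
- by have /= := H 0; move=> ->.
- by have /= := H 0.
- by have /= -> := H 0; rewrite IH // => k; have := H k.+1.
Qed.

Section Jump.
Variables (S : eqType) (dlt : S -> sym -> option (S * sym * int)).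

Definition jconf := (S * tape * int)%type.

(** States may be of any type and the head may jump by any integer. What makes this a Turing machine
    is a finite list of states closed under [dlt] together with a bound [D] on the jumps. *)
Definition jstep (c : jconf) : option jconf :=
  let: (s, T, h) := c in
  match dlt s (T h) with
  | None => None
  | Some (s', a, d) => Some (s', write T h a, (h + d)%R)
  end.

Inductive jruns : jconf -> nat -> jconf -> Prop :=
| JRefl c : jruns c 0 c
| JStep c c' c'' t : jstep c = Some c' -> jruns c' t c'' -> jruns c t.+1 c''.

Lemma jruns_trans c1 t1 c2 t2 c3 :
  jruns c1 t1 c2 -> jruns c2 t2 c3 -> jruns c1 (t1 + t2) c3.
Proof.
elim=> // {t1 c2 c1} c c' c'' t st _ IH r.
by rewrite addSn; apply: JStep st _; apply: IH.
Qed.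

Variables (l : seq S) (s0 : S) (D : nat).
Hypothesis s0l : s0 \in l.
Hypothesis closed : forall s a s' a' d, s \in l ->
  dlt s a = Some (s', a', d) -> s' \in l /\ (`|d| <= D)%N.

(* A state of the simulating machine also records how far the head still has
   to travel, in unit steps, before the current jump is complete. *)
Let states : seq (S * int) :=
  (s0, Posz 0) :: [seq (s, (Posz i - Posz D)%R) | s <- l, i <- iota 0 (2 * D).+1].

Let in_states s d : s \in l -> (`|d| <= D)%N -> (s, d) \in states.
Proof.
move=> sl dD; rewrite inE; apply/orP; right; apply/allpairsP.
exists (s, absz (d + Posz D)%R); split=> //; first by rewrite mem_iota /=; lia.
by congr (_, _) => /=; lia.
Qed.

Let N := (size states).-1.
Let code (sd : S * int) : 'I_N.+1 := inord (index sd states).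
Let decode (i : 'I_N.+1) : S * int := nth (s0, Posz 0) states i.

Let codeK sd : sd \in states -> decode (code sd) = sd.
Proof.
by move=> sd_in; rewrite /decode /code inordK ?nth_index //; move: sd_in; rewrite -index_mem.
Qed.

Definition jump_TM : TM := {| tm_Q := N; tm_delta := fun q a =>
  let: (s, d) := decode q in
  match d with
  | Posz 0 => if dlt s a is Some (s', a', d') then Some (code (s', d'), a', Stay) else None
  | Posz k.+1 => Some (code (s, Posz k), a, MoveR)
  | Negz k => Some (code (s, (- Posz k)%R), a, MoveL)
  end |}.

Let sim (c : config jump_TM) (s : S) (d : int) (T : tape) (h : int) :=
  [/\ decode (cf_state c) = (s, d), s \in l & represents c T h].

Let write_id T h : write T h (T h) = T.
Proof. by apply: functional_extensionality => z; rewrite /write; case: eqP => // ->. Qed.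

Let sim_move c s d T h : sim c s d T h -> (`|d| <= D)%N ->
  sim (exec `|d|%N c) s 0%R T (h + d)%R.
Proof.
elim: {d}`|d|%N {-2}d (erefl `|d|%N) c h => [|n IH] d en c h [eqs sl rep] dD.
  have d0 : d = 0%R by lia.
  by rewrite d0 addr0 /=; split=> //; rewrite eqs d0.
case: d en eqs dD => [[|k]|k] //= [en] eqs dD.
- have [|c' [st eq' rep']] := @step_represents jump_TM c T h (code (s, Posz k)) (T h) MoveR rep.
    by rewrite /= eqs.
  rewrite st; have := IH (Posz k) en c' (h + 1)%R.
  have -> : (h + 1 + Posz k = h + Posz k.+1)%R by lia.
  apply; last by lia.
  split=> //; last by rewrite write_id in rep'.
  by rewrite eq' codeK //; apply: in_states => //; lia.
- have [|c' [st eq' rep']] := @step_represents jump_TM c T h (code (s, (-Posz k)%R)) (T h) MoveL rep.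
    by rewrite /= eqs.
  have en' : absz (- Posz k)%R = k by lia.
  rewrite st; have := IH (- Posz k)%R (etrans en' en) c' (h + Negz 0)%R.
  rewrite en'.
  have -> : (h + Negz 0 + - Posz k = h + Negz k)%R by lia.
  apply; last exact: ltnW.
  split=> //; last by rewrite write_id in rep'.
  by rewrite eq' codeK //; apply: in_states => //; lia.
Qed.

Let sim_step c s T h s' T' h' : sim c s 0%R T h -> jstep (s, T, h) = Some (s', T', h') ->
  exists2 t, (t <= D.+1)%N & sim (exec t c) s' 0%R T' h'.
Proof.
move=> [eqs sl rep] /=; case E: (dlt s (T h)) => [[[s1 a] d]|] // [<- <- <-].
have [s1l dD] := closed sl E.
have [|c' [st eq' rep']] := @step_represents jump_TM c T h (code (s1, d)) a Stay rep.
  by rewrite /= eqs E.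
(* One step writes and changes state in place; the unit moves that follow complete the jump. *)
exists (`|d|%N).+1; first by lia.
rewrite /= st; apply: sim_move => //; split=> //; first by rewrite eq' codeK // in_states.
by move: rep'; rewrite /= addr0.
Qed.

Lemma jump_TM_correct x t s T h y :
  jruns (s0, input_tape x, 0%R) t (s, T, h) ->
  dlt s (T h) = None ->
  (forall k, T (h + Posz k)%R = nth None (map Some y) k) ->
  exists2 t', (t' <= t * D.+1)%N &
    halted (exec t' (init jump_TM x)) /\ output (exec t' (init jump_TM x)) = y.
Proof.
move=> runs dnone HT.
suff: forall c1 c2, jruns c1 t c2 -> forall c, sim c c1.1.1 0%R c1.1.2 c1.2 ->
   exists2 t', (t' <= t * D.+1)%N & sim (exec t' c) c2.1.1 0%R c2.1.2 c2.2.
  move=> /(_ _ _ runs (init jump_TM x)) /= [].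
    split=> //; last exact: init_represents.
    by case: (x) => [|? ?].
  move=> t' le_t' [eqs sl rep]; exists t' => //; split; last exact: output_represents rep HT.
  by rewrite /halted (halted_represents rep) //= eqs dnone.
move=> {runs dnone HT s T h x y} c1 c2; elim=> {c1 c2 t}.
  by move=> [[s T] h] c H; exists 0.
move=> [[s T] h] [[s' T'] h'] [[s2 T2] h2] t st _ IH c /= H.
have [t1 le1 H1] := sim_step H st.
have [t2 le2 H2] := IH _ H1.
by exists (t1 + t2); rewrite ?exec_add //; lia.
Qed.

End Jump.

(** * Stack machines *)

Definition store := nat -> seq bool.

Definition upd (st : store) (i : nat) (v : seq bool) : store :=
  fun j => if j == i then v else st j.

Lemma upd_same st i v : upd st i v i = v.
Proof. by rewrite /upd eqxx. Qed.

Lemma upd_other st i j v : j != i -> upd st i v j = st j.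
Proof. by rewrite /upd => /negbTE ->. Qed.

Inductive instr (P : Type) :=
| Halt
| Goto of P
| PushI of nat & bool & P
| PopI of nat & P & P & P.
Arguments Halt {P}.

Section Layout.
Variable K : nat.
Hypothesis K0 : 0 < K.

(** [base i] is the blank cell below stack [i], [stride i] the displacement from one entry to the
    next. Stacks 0 and 1 share the cell -1 as bottom marker and grow in opposite directions. *)
Definition base (i : nat) : int := if i is i'.+1 then Negz i' else Negz 0.
Definition stride (i : nat) : int := if i is 0 then Posz 1 else (- Posz K)%R.
Definition addr (i j : nat) : int :=
  if i is i'.+1 then Negz (i' + j.+1 * K) else Posz j.

(* Stack 0 occupies the cells to the right of the origin; stacks 1 .. K are
   interleaved to the left of it.  The K cells next to the origin on the left
   always stay blank and mark the bottoms of the stacks. *)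
Definition layout (st : store) : tape := fun z =>
  match z with
  | Posz j => nth None (map Some (rev (st 0))) j
  | Negz p => if p < K then None
              else nth None (map Some (rev (st (p %% K).+1))) (p %/ K).-1
  end.

Lemma addrE i j : addr i j = (base i + Posz j.+1 * stride i)%R.
Proof. by case: i => [|i] /=; rewrite ?mulrN -?PoszM; lia. Qed.

Lemma addr_next i j : (addr i j + stride i = addr i j.+1)%R.
Proof. by rewrite !addrE; lia. Qed.

Lemma addr_prev i j : (addr i j.+1 - stride i = addr i j)%R.
Proof. by rewrite !addrE; lia. Qed.

Lemma addr_first i : (base i + stride i)%R = addr i 0.
Proof. by rewrite addrE; lia. Qed.

Lemma addr_bottom i : (addr i 0 - stride i)%R = base i.
Proof. by rewrite addrE; lia. Qed.

Lemma layout_addr st i j : i <= K ->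
  layout st (addr i j) = nth None (map Some (rev (st i))) j.
Proof.
case: i => [|i] //= iK; rewrite ltnNge mulSn addnCA leq_addr /=.
by rewrite addnCA -mulSn addnC modnMDl divnMDl // modn_small // divn_small // addn0.
Qed.

Lemma layout_base st i : i <= K -> layout st (base i) = None.
Proof. by case: i => [|i] //= H; rewrite ?K0 ?H. Qed.

Lemma addr_inj i j i' j' : i <= K -> i' <= K -> addr i j = addr i' j' -> i = i' /\ j = j'.
Proof.
case: i i' => [|i] [|i'] //= iK iK'; first by case.
case=> E; have := congr1 (modn^~ K) E; have := congr1 (divn^~ K) E => /=.
by rewrite ![_ + _ * K]addnC !modnMDl !divnMDl // !modn_small // !divn_small // !addn0 => [[->]] ->.
Qed.

Lemma addrP z : (exists i j, i <= K /\ z = addr i j) \/ (forall st, layout st z = None).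
Proof.
case: z => [j|p]; first by left; exists 0, j.
case: (ltnP p K) => pK; first by right=> st /=; rewrite pK.
left; exists (p %% K).+1, (p %/ K).-1; split; first by rewrite ltn_mod.
have d0 : 0 < p %/ K by rewrite divn_gt0.
by rewrite /= prednK // addnC -divn_eq.
Qed.

Lemma write_layout st i j a v : i <= K ->
  (forall j', nth None (map Some (rev v)) j' =
     if j' == j then a else nth None (map Some (rev (st i))) j') ->
  write (layout st) (addr i j) a = layout (upd st i v).
Proof.
move=> iK H; apply: functional_extensionality => z; rewrite /write.
case: (addrP z) => [[i' [j' [iK' ->]]]|none].
  rewrite !layout_addr //; case: eqP => [/addr_inj[] // -> ->|ne].
    by rewrite upd_same H eqxx.
  case: (eqVneq i' i) => [ii|ii]; last by rewrite upd_other.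
  by rewrite ii upd_same H; case: eqP => // jj; case: ne; rewrite ii jj.
case: eqP => [e|_]; last by rewrite !none.
by rewrite e layout_addr // upd_same H eqxx.
Qed.

Local Arguments layout : simpl never.

Lemma write_push st i b : i <= K ->
  write (layout st) (addr i (size (st i))) (Some b) = layout (upd st i (b :: st i)).
Proof.
move=> iK; apply: write_layout => // j.
rewrite rev_cons map_rcons nth_rcons size_map size_rev.
case: ltngtP => // H; by rewrite nth_default // size_map size_rev ltnW.
Qed.

Lemma write_pop st i b s : i <= K -> st i = b :: s ->
  write (layout st) (addr i (size s)) None = layout (upd st i s).
Proof.
move=> iK E; apply: write_layout => // j.
rewrite E rev_cons map_rcons nth_rcons size_map size_rev.
by case: (ltngtP j (size s)) => // H; rewrite nth_default // size_map size_rev; lia.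
Qed.

Lemma write_same st z : write (layout st) z (layout st z) = layout st.
Proof. by apply: functional_extensionality => y; rewrite /write; case: eqP => // ->. Qed.

Variables (P : eqType) (op : P -> instr P).

(* Phases: 0 fetches the instruction, 1 walks up to the first blank above a
   stack, 2 inspects the top symbol, 3 + i walks back down along stack i. *)
Definition sdelta (pp : P * nat) (a : sym) : option (P * nat * sym * int) :=
  let: (p, ph) := pp in
  match ph with
  | 0 => match op p with
         | Halt => None
         | Goto p' => Some ((p', 0), a, Posz 0)
         | PushI i _ _ | PopI i _ _ _ => Some ((p, 1), a, (base i + stride i)%R)
         end
  | 1 => match op p, a with
         | PushI i b p', None => Some ((p', i.+3), Some b, (- stride i)%R)
         | PopI i _ _ _, None => Some ((p, 2), None, (- stride i)%R)
         | PushI i _ _, Some _ | PopI i _ _ _, Some _ => Some ((p, 1), a, stride i)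
         | _, _ => None
         end
  | 2 => match op p, a with
         | PopI i pe _ _, None => Some ((pe, 0), None, (- base i)%R)
         | PopI i _ p0 p1, Some b => Some ((if b then p1 else p0, i.+3), None, (- stride i)%R)
         | _, _ => None
         end
  | i.+3 => match a with
            | None => Some ((p, 0), None, (- base i)%R)
            | Some _ => Some ((p, i.+3), a, (- stride i)%R)
            end
  end.

Definition pconf := (P * store)%type.

Definition pstep (c : pconf) : option pconf :=
  let: (p, st) := c in
  match op p with
  | Halt => None
  | Goto p' => Some (p', st)
  | PushI i b p' => Some (p', upd st i (b :: st i))
  | PopI i pe p0 p1 =>
      match st i with
      | [::] => Some (pe, st)
      | b :: s => Some (if b then p1 else p0, upd st i s)
      end
  end.

Inductive pruns : pconf -> nat -> pconf -> Prop :=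
| PRefl c : pruns c 0 c
| PStep c c' c'' t : pstep c = Some c' -> pruns c' t c'' -> pruns c t.+1 c''.

Variable l : seq P.

Hypothesis closed : forall p, p \in l ->
  match op p with
  | Halt => True
  | Goto p' => p' \in l
  | PushI i _ p' => i <= K /\ p' \in l
  | PopI i pe p0 p1 => [/\ i <= K, pe \in l, p0 \in l & p1 \in l]
  end.

Notation jr := (jruns sdelta).

Let jr1 c c' c'' t : jstep sdelta c = Some c' -> jr c' t c'' -> jr c t.+1 c''.
Proof. exact: JStep. Qed.

Let walk_up p st i j : i <= K ->
  (exists b p', op p = PushI i b p') \/ (exists pe p0 p1, op p = PopI i pe p0 p1) ->
  j <= size (st i) ->
  jr ((p, 1), layout st, addr i 0) j ((p, 1), layout st, addr i j).
Proof.
move=> iK hop; elim: j => [|j IH] jl; first exact: JRefl.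
have := IH (ltnW jl); rewrite -(addn1 j) => r; apply: jruns_trans r _.
rewrite addn1; apply: JStep (JRefl _ _).
rewrite /jstep /=.
have E : exists b, layout st (addr i j) = Some b.
  rewrite layout_addr // (nth_map false) ?size_rev //; by eexists.
case: E => b E; rewrite -addr_next.
by case: hop => [[? [? ->]]|[? [? [? ->]]]]; rewrite E /= -E write_same.
Qed.

Let walk_down p st i j : i <= K -> j <= size (st i) ->
  jr ((p, i.+3), layout st, (addr i j - stride i)%R) j.+1 ((p, 0), layout st, 0%R).
Proof.
move=> iK; elim: j => [|j IH] jl.
  apply: JStep (JRefl _ _); rewrite addr_bottom /jstep /= layout_base //=.
  by rewrite -[X in write _ _ X](layout_base st iK) write_same subrr.
apply: JStep (IH (ltnW jl)); rewrite addr_prev /jstep /=.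
have [b E] : exists b, layout st (addr i j) = Some b.
  rewrite layout_addr // (nth_map false) ?size_rev //; by eexists.
by rewrite E /= -E write_same.
Qed.

Let sim_pstep p st p' st' : p \in l -> pstep (p, st) = Some (p', st') ->
  p' \in l /\ exists t, (exists i, t <= 2 * size (st i) + 4) /\
    jr ((p, 0), layout st, 0%R) t ((p', 0), layout st', 0%R).
Proof.
move=> pl; have := closed pl; rewrite /pstep; case E: (op p) => [|q|i b q|i qe q0 q1] //.
- move=> ql [<- <-]; split=> //; exists 1; split; first by exists 0; lia.
  by apply: JStep (JRefl _ _); rewrite /jstep /= E addr0 write_same.
- move=> [iK ql] [<- <-]; split=> //; exists (1 + (size (st i) + (1 + (size (st i)).+1))).
  split; first by exists i; lia.
  apply: jr1; first by rewrite /jstep /= E write_same add0r addr_first.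
  apply: jruns_trans; first by apply: walk_up => //; left; exists b, q.
  apply: jr1.
    by rewrite /jstep /= E layout_addr // nth_default ?size_map ?size_rev.
  by rewrite write_push //; apply: walk_down => //; rewrite upd_same /= ltnW.
- move=> [iK qel q0l q1l] st1.
  have go t c : jr ((p, 2), layout st, (addr i (size (st i)) - stride i)%R) t c ->
     jr ((p, 0), layout st, 0%R) (1 + (size (st i) + (1 + t))) c.
    move=> H; apply: jr1; first by rewrite /jstep /= E write_same add0r addr_first.
    apply: jruns_trans; first by apply: walk_up => //; right; exists qe, q0, q1.
    apply: jr1 H.
    have none : layout st (addr i (size (st i))) = None.
      by rewrite layout_addr // nth_default ?size_map ?size_rev.
    rewrite /jstep /= none E; do 3 f_equal.
    by rewrite -[X in write _ _ X]none write_same.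
  case Es: (st i) st1 => [|b s] [<- <-].
    split=> //; exists (1 + (size (st i) + (1 + 1))); split; first by exists i; lia.
    apply: go; apply: JStep (JRefl _ _).
    rewrite Es addr_bottom /jstep /= layout_base // E subrr; do 3 f_equal.
    by rewrite -[X in write _ _ X](layout_base st iK) write_same.
  split; first by case: b {Es}.
  exists (1 + (size (st i) + (1 + (1 + (size s).+1)))); split.
    by exists i; rewrite Es /=; lia.
  apply: go; rewrite Es /= addr_prev; apply: jr1.
    rewrite /jstep /= layout_addr // Es rev_cons map_rcons nth_rcons size_map size_rev ltnn eqxx E.
    by [].
  by rewrite (write_pop _ Es) //; apply: walk_down => //; rewrite upd_same.
Qed.

Let pstep_size p st p' st' i : pstep (p, st) = Some (p', st') -> size (st' i) <= (size (st i)).+1.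
Proof.
rewrite /pstep; case: (op p) => [|q|k b q|k qe q0 q1] //.
- by case=> _ <-.
- by case=> _ <-; rewrite /upd; case: eqP => // ->.
- case E: (st k) => [|b s] [_ <-] //; rewrite /upd; case: eqP => // ->.
  by rewrite E /=; lia.
Qed.

(** A step raises a stack by at most one, so no stack exceeds [m + t]; an instruction walks up and
    down a single stack, hence a bound quadratic in [t]. *)
Let sim_pruns p st t p' st' m : p \in l -> pruns (p, st) t (p', st') ->
  (forall i, size (st i) <= m) ->
  exists2 t', t' <= t * (2 * (m + t) + 4) &
    jr ((p, 0), layout st, 0%R) t' ((p', 0), layout st', 0%R).
Proof.
move=> pl r.
have: forall c1 c2, pruns c1 t c2 -> forall m, c1.1 \in l -> (forall i, size (c1.2 i) <= m) ->
  exists2 t', t' <= t * (2 * (m + t) + 4) &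
    jr ((c1.1, 0), layout c1.2, 0%R) t' ((c2.1, 0), layout c2.2, 0%R).
  move=> {p st p' st' pl r m} c1 c2; elim=> {c1 c2 t}.
    by move=> [p st] m pl _; exists 0 => //; apply: JRefl.
  move=> [p st] [p' st'] [p2 st2] t s1 _ /= IH m pl sz.
  have [pl' [t1 [[i le1] r1]]] := sim_pstep pl s1.
  have [|j|t2 le2 r2] := IH m.+1 => //.
    by apply: leq_trans (pstep_size _ s1) _; rewrite ltnS.
  exists (t1 + t2); last exact: jruns_trans r1 r2.
  by have := sz i; nia.
move=> /(_ _ _ r m) /=; exact.
Qed.

Variable p0 : P.
Hypothesis p0l : p0 \in l.

(** Stack 0 has its bottom at the origin and its top at the far end, so the first input bit lies
    deepest. The output is reversed for the same reason. *)
Definition start_store (x : seq bool) : store := fun i => if i is 0 then rev x else [::].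

Let layout_start x : layout (start_store x) = input_tape x.
Proof.
apply: functional_extensionality => -[j|p]; rewrite /layout /= ?revK //.
by rewrite nth_nil; case: ifP.
Qed.

Lemma stack_machine_TM : exists (M : TM) (c : nat), forall x t p' st',
  pruns (p0, start_store x) t (p', st') -> op p' = Halt ->
  exists2 t', t' <= t * (2 * (size x + t) + 4) * c &
    halted (exec t' (init M x)) /\ output (exec t' (init M x)) = rev (st' 0).
Proof.
(* The phases are 0, 1, 2 and [i.+3] with [i <= K], all below [K + 4]. *)
pose L := [seq (p, ph) | p <- l, ph <- iota 0 (K + 4)].
have inL p ph : ph < K + 4 -> p \in l -> (p, ph) \in L.
  by move=> phK pl; apply/allpairsP; exists (p, ph); rewrite mem_iota.
have mem0 : (p0, 0) \in L by apply: inL => //; lia.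
have cl s a s' a' d : s \in L -> sdelta s a = Some (s', a', d) ->
  s' \in L /\ `|d|%N <= (2 * K).+1.
  case: s => p ph /allpairsP [[p1 ph1] /= [pl phK [e1 e2]]]; subst p1 ph1.
  move: phK; rewrite mem_iota /= => phK; have := closed pl.
  have b_le i : i <= K -> `|base i|%N <= K by case: i => [|i] /=; lia.
  have s_le i : `|stride i|%N <= K by case: i => [|i] /=; lia.
  case: ph phK => [|[|[|i]]] phK /=.
  - case: (op p) => [|q|i b q|i qe q0 q1] //.
    + by move=> ql [<- _ <-]; split=> //; apply: inL; lia.
    + move=> [iK ql] [<- _ <-]; split; first by apply: inL => //; lia.
      by have := b_le i iK; have := s_le i; lia.
    + move=> [iK qel q0l q1l] [<- _ <-]; split; first by apply: inL => //; lia.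
      by have := b_le i iK; have := s_le i; lia.
  - case: (op p) => [|q|i b q|i qe q0 q1] //.
    + move=> [iK ql]; case: a => [a|] [<- _ <-]; have := s_le i.
        by split; [apply: inL => //; lia | lia].
      by split; [apply: inL => //; lia | lia].
    + move=> [iK qel q0l q1l]; case: a => [a|] [<- _ <-]; have := s_le i.
        by split; [apply: inL => //; lia | lia].
      by split; [apply: inL => //; lia | lia].
  - case: (op p) => [|q|i b q|i qe q0 q1] //.
    move=> [iK qel q0l q1l]; case: a => [a|] [<- _ <-]; have := s_le i; have := b_le i iK.
      by split; [apply: inL; [lia | by case: ifP] | lia].
    by split; [apply: inL => //; lia | lia].
  - move=> _; have iK : i <= K by lia.
    case: a => [a|] [<- _ <-]; have := s_le i; have := b_le i iK.
      by split; [apply: inL => //; lia | lia].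
    by split; [apply: inL => //; lia | lia].
exists (jump_TM sdelta L (p0, 0) (2 * K).+1), (2 * K).+2 => x t p' st' r hp.
have sz i : size (start_store x i) <= size x by case: i => //=; rewrite size_rev.
have [t1 le1 r1] := sim_pruns p0l r sz.
rewrite layout_start in r1.
have [||t2 le2 H] := jump_TM_correct (y := rev (st' 0)) mem0 cl r1.
- by rewrite /= hp.
- by move=> k; rewrite add0r.
by exists t2 => //; apply: leq_trans le2 _; rewrite leq_mul2r le1 orbT.
Qed.

End Layout.

(** * Structured programs *)

(** [Loop i c0 c1] pops stack [i] until it is empty, running [c0] or [c1] according to each bit
    popped. [IfPop i ce c0 c1] pops once, and runs [ce] if the stack is empty. *)
Inductive cmd :=
| Skip
| Push of nat & bool
| Seq of cmd & cmd
| Loop of nat & cmd & cmd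
| IfPop of nat & cmd & cmd & cmd.

Lemma cmd_comparable : comparable cmd.
Proof. by rewrite /comparable /decidable; decide equality; apply: eq_comparable. Qed.

HB.instance Definition _ := comparableMixin cmd_comparable.

Definition cmd_op (k : seq cmd) : instr (seq cmd) :=
  match k with
  | [::] => Halt
  | Skip :: k => Goto k
  | Push i b :: k => PushI i b k
  | Seq c1 c2 :: k => Goto (c1 :: c2 :: k)
  | Loop i c0 c1 :: k' => PopI i k' (c0 :: k) (c1 :: k)
  | IfPop i ce c0 c1 :: k => PopI i (ce :: k) (c0 :: k) (c1 :: k)
  end.

(** A program point is the list of commands still to be run. Only finitely many arise from [c :: k],
    because a loop body is followed by that very loop again; they supply the finite state set. *)
Fixpoint conts (c : cmd) (k : seq cmd) : seq (seq cmd) :=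
  (c :: k) ::
  match c with
  | Skip | Push _ _ => [::]
  | Seq c1 c2 => conts c1 (c2 :: k) ++ conts c2 k
  | Loop _ c0 c1 => conts c0 (c :: k) ++ conts c1 (c :: k)
  | IfPop _ ce c0 c1 => conts ce k ++ conts c0 k ++ conts c1 k
  end.

Fixpoint max_stack (c : cmd) : nat :=
  match c with
  | Skip => 0
  | Push i _ => i
  | Seq c1 c2 => maxn (max_stack c1) (max_stack c2)
  | Loop i c0 c1 => maxn i (maxn (max_stack c0) (max_stack c1))
  | IfPop i ce c0 c1 =>
      maxn i (maxn (max_stack ce) (maxn (max_stack c0) (max_stack c1)))
  end.

Definition succ_in (K : nat) (l : seq (seq cmd)) (p : seq cmd) : Prop :=
  match cmd_op p with
  | Halt => True
  | Goto p' => p' \in l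
  | PushI i _ p' => i <= K /\ p' \in l
  | PopI i pe p0 p1 => [/\ i <= K, pe \in l, p0 \in l & p1 \in l]
  end.

Lemma conts_head c k : c :: k \in conts c k.
Proof. by case: c => *; rewrite inE eqxx. Qed.

Lemma succ_in_sub K (l l' : seq (seq cmd)) p :
  {subset l <= l'} -> succ_in K l p -> succ_in K l' p.
Proof.
move=> sub; rewrite /succ_in; case: (cmd_op p) => // [i b q|i pe p0 p1].
- by case=> ? /sub.
- by case=> ? /sub ? /sub ? /sub.
Qed.

Lemma conts_closed K c k p : max_stack c <= K -> p \in conts c k ->
  succ_in K (k :: conts c k) p.
Proof.
elim: c k => [|i b|c1 IH1 c2 IH2|i c0 IH0 c1 IH1|i ce IHe c0 IH0 c1 IH1] k /= mK.
- by rewrite inE => /eqP ->; rewrite /succ_in /= inE eqxx.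
- by rewrite inE => /eqP ->; rewrite /succ_in /= inE eqxx.
- move: mK; rewrite geq_max => /andP[m1 m2].
  rewrite in_cons mem_cat => /orP[/eqP ->|/orP[/(IH1 _ m1)|/(IH2 _ m2)]].
  + by rewrite /succ_in /= !inE mem_cat conts_head !orbT.
  + apply: succ_in_sub => q; rewrite inE => /orP[/eqP ->|qin].
      by rewrite !inE !mem_cat conts_head !orbT.
    by rewrite !inE !mem_cat qin !orbT.
  + apply: succ_in_sub => q; rewrite !inE => /orP[->|qin] //.
    by rewrite !mem_cat qin !orbT.
- move: mK; rewrite !geq_max => /and3P[iK m0 m1].
  rewrite in_cons mem_cat => /orP[/eqP ->|/orP[/(IH0 _ m0)|/(IH1 _ m1)]].
  + by rewrite /succ_in /= !inE !mem_cat !conts_head eqxx !orbT.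
  + apply: succ_in_sub => q; rewrite !inE => /orP[->|qin]; rewrite ?orbT //.
    by rewrite !mem_cat qin !orbT.
  + apply: succ_in_sub => q; rewrite !inE => /orP[->|qin]; rewrite ?orbT //.
    by rewrite !mem_cat qin !orbT.
- move: mK; rewrite !geq_max => /and4P[iK me m0 m1].
  rewrite in_cons !mem_cat => /orP[/eqP ->|/or3P[/(IHe _ me)|/(IH0 _ m0)|/(IH1 _ m1)]].
  + by rewrite /succ_in /= !inE !mem_cat !conts_head !orbT.
  + apply: succ_in_sub => q; rewrite !inE => /orP[->|qin]; rewrite ?orbT //.
    by rewrite !mem_cat qin !orbT.
  + apply: succ_in_sub => q; rewrite !inE => /orP[->|qin]; rewrite ?orbT //.
    by rewrite !mem_cat qin !orbT.
  + apply: succ_in_sub => q; rewrite !inE => /orP[->|qin]; rewrite ?orbT //.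
    by rewrite !mem_cat qin !orbT.
Qed.

Notation cruns := (pruns cmd_op).

(** The number of steps is chosen before the continuation [k], so that the costs of consecutive
    commands add up. *)
Definition cost (c : cmd) (st st' : store) (T : nat) : Prop :=
  exists2 t, t <= T & forall k, cruns (c :: k, st) t (k, st').

Lemma pruns_trans (P : eqType) (op : P -> instr P) c1 t1 c2 t2 c3 :
  pruns op c1 t1 c2 -> pruns op c2 t2 c3 -> pruns op c1 (t1 + t2) c3.
Proof.
elim=> // {t1 c2 c1} c c' c'' t st _ IH r.
by rewrite addSn; apply: PStep st _; apply: IH.
Qed.

Lemma cost_le c st st' T T' : cost c st st' T -> T <= T' -> cost c st st' T'.
Proof. by case=> t le r le'; exists t => //; apply: leq_trans le'. Qed.

Lemma cost_skip st : cost Skip st st 1.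
Proof. by exists 1 => // k; apply: PStep (PRefl _ _). Qed.

Lemma cost_push st i b : cost (Push i b) st (upd st i (b :: st i)) 1.
Proof. by exists 1 => // k; apply: PStep (PRefl _ _). Qed.

Lemma cost_seq c1 c2 st st1 st2 T1 T2 :
  cost c1 st st1 T1 -> cost c2 st1 st2 T2 -> cost (Seq c1 c2) st st2 (T1 + T2).+1.
Proof.
move=> [t1 le1 r1] [t2 le2 r2]; exists (t1 + t2).+1; first by rewrite ltnS leq_add.
move=> k; apply: (@PStep _ _ _ (c1 :: c2 :: k, st)) => //.
by apply: pruns_trans (r1 _) (r2 _).
Qed.

Lemma cost_ifpop_nil i ce c0 c1 st st' T : st i = [::] ->
  cost ce st st' T -> cost (IfPop i ce c0 c1) st st' T.+1.
Proof.
move=> E [t le r]; exists t.+1 => // k.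
by apply: (@PStep _ _ _ (ce :: k, st)) => //=; rewrite E.
Qed.

Lemma cost_ifpop_cons i ce c0 c1 st st' T b s : st i = b :: s ->
  cost (if b then c1 else c0) (upd st i s) st' T -> cost (IfPop i ce c0 c1) st st' T.+1.
Proof.
move=> E [t le r]; exists t.+1 => // k.
apply: (@PStep _ _ _ ((if b then c1 else c0) :: k, upd st i s)) => //=; rewrite E.
by case: b {E r}.
Qed.

Lemma cost_loop i c0 c1 (I : nat -> store) (s : seq bool) B :
  (forall j, j <= size s -> I j i = drop j s) ->
  (forall j, j < size s ->
    cost (if nth false s j then c1 else c0) (upd (I j) i (drop j.+1 s)) (I j.+1) B) ->
  cost (Loop i c0 c1) (I 0) (I (size s)) (size s * B.+1 + 1).
Proof.
move=> Hi Hb.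
suff: forall n j, n + j = size s ->
    cost (Loop i c0 c1) (I j) (I (size s)) (n * B.+1 + 1).
  by apply; rewrite addn0.
elim=> [|n IH] j nj.
  rewrite add0n in nj; rewrite nj; exists 1 => // k; apply: PStep (PRefl _ _) => /=.
  by rewrite Hi // drop_size.
have js : j < size s by lia.
have [t1 le1 r1] := Hb _ js.
have [|t2 le2 r2] := IH j.+1; first by lia.
exists (t1 + t2).+1; first by lia.
move=> k; pose b := nth false s j.
apply: (@PStep _ _ _ ((if b then c1 else c0) :: Loop i c0 c1 :: k, upd (I j) i (drop j.+1 s))).
  by rewrite /= Hi 1?ltnW // (drop_nth false js) -/b; case: b.
exact: pruns_trans (r1 _) (r2 _).
Qed.

Definition pushes (b : bool) (l : seq nat) : cmd :=
  foldr (fun i => Seq (Push i b)) Skip l.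

Lemma cost_pushes b l st : uniq l ->
  cost (pushes b l) st (fun k => if k \in l then b :: st k else st k) (2 * size l + 1).
Proof.
elim: l st => [|i l IH] st /= => [_|/andP[il /IH{}IH]]; first exact: cost_skip.
apply: cost_le (cost_seq (cost_push _ _ _) _) _.
- set st' := (X in cost _ _ X).
  have -> : st' = (fun k => if k \in l then b :: (upd st i (b :: st i)) k else upd st i (b :: st i) k).
    apply: functional_extensionality => k; rewrite /st' inE /upd.
    by case: eqP => [->|] //=; rewrite (negbTE il).
  exact: IH.
- by move: (size l) => n; lia.
Qed.

(** Each stack of [copies] receives the bits of stack [i] in reversed order, each stack of
    [counters] one unit per bit. Draining to the scratch stack and back is how a stack is read
    without losing it. *)
Definition drain (i : nat) (copies counters : seq nat) : cmd :=
  let body b := Seq (pushes b copies) (pushes true counters) in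
  Loop i (body false) (body true).

Definition drained (i : nat) (copies counters : seq nat) (st : store) : store :=
  fun k => if k == i then [::]
           else if k \in copies then rev (st i) ++ st k
           else if k \in counters then nseq (size (st i)) true ++ st k
           else st k.

Lemma cost_drain i l1 l2 st : uniq (l1 ++ l2) -> i \notin l1 ++ l2 ->
  cost (drain i l1 l2) st (drained i l1 l2 st)
    (size (st i) * (2 * (size l1 + size l2) + 4) + 1).
Proof.
rewrite cat_uniq mem_cat => /and3P[u1 /hasPn dis u2] /norP[i1 i2].
pose I j : store := fun k => if k == i then drop j (st i)
  else if k \in l1 then rev (take j (st i)) ++ st k
  else if k \in l2 then nseq j true ++ st k else st k.
have -> : drained i l1 l2 st = I (size (st i)).
  apply: functional_extensionality => k; rewrite /drained /I.
  by rewrite drop_size take_size.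
have {1}-> : st = I 0.
  apply: functional_extensionality => k; rewrite /I drop0 take0.
  by case: eqP => [->|] //; do ?case: ifP.
apply: cost_le (cost_loop (B := (2 * (size l1 + size l2) + 3)) _ _) _ => [j _|j js|].
- by rewrite /I eqxx.
- set b := nth false _ _; set st1 := upd _ _ _.
  rewrite (_ : (if b then _ else _) = Seq (pushes b l1) (pushes true l2)); last by case: (b).
  apply: cost_le (cost_seq (cost_pushes _ _ u1) _) _.
  + set st2 := fun k => _.
    have -> : I j.+1 = fun k => if k \in l2 then true :: st2 k else st2 k.
      apply: functional_extensionality => k; rewrite /I /st2 /st1 /upd /I.
      case: (eqVneq k i) => [->|ki]; first by rewrite (negbTE i1) (negbTE i2).
      case k1: (k \in l1); case k2: (k \in l2) => //.
        by have := dis _ k2; rewrite k1.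
      by rewrite (take_nth false js) rev_rcons.
    exact: cost_pushes.
  + by lia.
- by nia.
Qed.

(** * Polynomial bounds *)

(** For positive [n], [n + 2 <= 3 * n] accounts for the factor [3 ^ k], and [k <= 3 ^ k] lets the
    same number serve as exponent. At [n = 0] the additive constant covers [2 ^ k]. *)
Lemma leq_exp_polybound k n : (n + 2) ^ k <= polybound (3 ^ k) n.
Proof.
have k3 : k <= 3 ^ k by apply: ltnW; apply: ltn_expl.
rewrite /polybound; case: n => [|n].
  by rewrite add0n; apply: leq_trans (leq_addl _ _); case: (k) => // j; rewrite leq_exp2r.
apply: leq_trans (leq_addr _ _).
apply: (@leq_trans ((3 * n.+1) ^ k)); first by case: (k) => // j; rewrite leq_exp2r //; lia.
by rewrite expnMn leq_mul2l leq_pexp2l // orbT.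
Qed.

(** The base [n + 2] is at least 2 even for [n = 0], so constants and sums are absorbed by a larger
    exponent and the closure properties need no leading coefficient. *)
Definition poly_bounded (g : nat -> nat) : Prop := exists k, forall n, g n <= (n + 2) ^ k.

Lemma poly_const c : poly_bounded (fun _ => c).
Proof.
exists c => n; apply: ltnW; apply: ltn_expl; lia.
Qed.

Lemma poly_id : poly_bounded id.
Proof. by exists 1 => n; rewrite expn1; lia. Qed.

Lemma poly_mul g h : poly_bounded g -> poly_bounded h -> poly_bounded (fun n => g n * h n).
Proof. by move=> [a Ha] [b Hb]; exists (a + b) => n; rewrite expnD leq_mul. Qed.

Lemma poly_add g h : poly_bounded g -> poly_bounded h -> poly_bounded (fun n => g n + h n).
Proof.
move=> [a Ha] [b Hb]; exists (a + b + 1) => n; rewrite !expnD expn1.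
have := Ha n; have := Hb n.
have : 0 < (n + 2) ^ a by rewrite expn_gt0; lia.
have : 0 < (n + 2) ^ b by rewrite expn_gt0; lia.
move: ((n + 2) ^ a) ((n + 2) ^ b) => X Y; nia.
Qed.

Lemma poly_comp g h : poly_bounded g -> poly_bounded h -> poly_bounded (fun n => g (h n)).
Proof.
move=> [a Ha] [b Hb]; exists ((b + 2) * a) => n.
apply: leq_trans (Ha _) _; rewrite expnM; case: (a) => // j.
rewrite leq_exp2r // expnD; have := Hb n.
have : 0 < (n + 2) ^ b by rewrite expn_gt0; lia.
move: ((n + 2) ^ b) => X; nia.
Qed.

Lemma program_poly_time (c : cmd) (f : seq bool -> seq bool) (g : nat -> nat) :
  poly_bounded g ->
  (forall x, exists2 st, cost c (start_store x) st (g (size x)) & rev (st 0) = f x) ->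
  poly_time_computable f.
Proof.
move=> pg H.
pose K := (max_stack c).+1.
pose l := [::] :: conts c [::].
have cl : forall p, p \in l -> succ_in K l p.
  by move=> p; rewrite inE => /orP[/eqP ->|] //; apply: conts_closed; apply: leqW.
have cl0 : [:: c] \in l by rewrite inE conts_head orbT.
have [M [D HM]] := stack_machine_TM (ltn0Sn _) cl cl0.
have [k Hk] : poly_bounded (fun n => g n * (2 * (n + g n) + 4) * D).
  apply: poly_mul (poly_mul pg _) (poly_const D).
  apply: poly_add _ (poly_const 4); apply: poly_mul (poly_const 2) _.
  exact: poly_add poly_id pg.
exists M, (3 ^ k) => x.
have [st [t le r] <-] := H x.
have [t' le' R] := HM x t [::] st (r _) erefl.
exists t'; split=> //.
apply: leq_trans le' _; apply: leq_trans (leq_exp_polybound _ _).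
apply: leq_trans (Hk _); rewrite leq_mul2r; apply/orP; right; apply: leq_mul => //; lia.
Qed.

(** * Arithmetic expressions over the input *)

(** Variables are de Bruijn indices and [Sum a b] binds index 0 in [b]. Products, quotients and
    bounded quantifiers are not primitive; they are obtained from bounded sums. *)
Inductive expr :=
| Const of nat
| Var of nat
| Len
| Bit of expr
| Add of expr & expr
| Monus of expr & expr
| Sum of expr & expr.

Definition scons (i : nat) (env : nat -> nat) : nat -> nat :=
  fun j => if j is j'.+1 then env j' else i.

Fixpoint eval (x : seq bool) (env : nat -> nat) (e : expr) : nat :=
  match e with
  | Const n => n
  | Var i => env i
  | Len => size x
  | Bit a => nth false x (eval x env a)
  | Add a b => eval x env a + eval x env b
  | Monus a b => eval x env a - eval x env b
  | Sum a b => \sum_(i < eval x env a) eval x (scons i env) b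
  end.

(* Stack 1 holds the input, stack 2 is scratch space; numbers are held in
   unary.  [comp vs l r e] adds the value of [e] to stack [r]; it takes the
   values of the variables from the stacks [vs] and may use the stacks from
   [l] on, which it finds and leaves empty. *)
Fixpoint comp (vs : seq nat) (l r : nat) (e : expr) : cmd :=
  match e with
  | Const n => iter n (Seq (Push r true)) Skip
  | Var i => if i < size vs then
               Seq (drain (nth 0 vs i) [:: 2] [::]) (drain 2 [:: nth 0 vs i; r] [::])
             else Skip
  | Len => Seq (drain 1 [:: 2] [:: r]) (drain 2 [:: 1] [::])
  | Bit a =>
      Seq (Push l true) (Seq (comp vs l.+1 l a) (Seq
        (Loop 1
           (Seq (Push 2 false) (IfPop l Skip Skip Skip))
           (Seq (Push 2 true)
              (IfPop l Skip Skip (IfPop l (Push r true) Skip (Push l true)))))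
        (Seq (drain 2 [:: 1] [::]) (drain l [::] [::]))))
  | Add a b => Seq (comp vs l r a) (comp vs l r b)
  | Monus a b =>
      Seq (comp vs l.+1 l a) (Seq (comp vs l.+2 l.+1 b) (Seq
        (Loop l.+1 Skip (IfPop l Skip Skip Skip)) (drain l [:: r] [::])))
  | Sum a b =>
      Seq (comp vs l.+1 l a) (Seq
        (Loop l Skip (Seq (comp (l.+1 :: vs) l.+2 r b) (Push l.+1 true)))
        (drain l.+1 [::] [::]))
  end.

(** [N] bounds the input length and all variables. Under the binder of [Sum a b] the new variable is
    below the value of [a], so [N + value_bound a N] is a bound there. *)
Fixpoint value_bound (e : expr) (N : nat) : nat :=
  match e with
  | Const n => n
  | Var _ | Len => N
  | Bit _ => 1
  | Add a b => value_bound a N + value_bound b N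
  | Monus a b => value_bound a N
  | Sum a b => value_bound a N * value_bound b (N + value_bound a N)
  end.

Fixpoint time_bound (e : expr) (N : nat) : nat :=
  match e with
  | Const n => 2 * n + 1
  | Var _ | Len => 20 * N + 20
  | Bit a => time_bound a N + 20 * N + 20 * value_bound a N + 40
  | Add a b => time_bound a N + time_bound b N + 1
  | Monus a b => time_bound a N + time_bound b N
                 + 20 * value_bound a N + 20 * value_bound b N + 20
  | Sum a b => time_bound a N
                 + value_bound a N * (time_bound b (N + value_bound a N) + 20) + 20
  end.

Lemma poly_value_bound e : poly_bounded (value_bound e).
Proof.
elim: e => [n|i||a IHa|a IHa b IHb|a IHa b IHb|a IHa b IHb] /=.
- exact: poly_const.
- exact: poly_id.
- exact: poly_id.
- exact: poly_const.
- exact: poly_add.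
- exact: IHa.
- apply: (poly_mul IHa (poly_comp (g := value_bound b) IHb _)).
  exact: poly_add poly_id IHa.
Qed.

Lemma poly_time_bound e : poly_bounded (time_bound e).
Proof.
have pv := poly_value_bound.
have lin c g : poly_bounded g -> poly_bounded (fun n => c * g n).
  by move=> Hg; apply: poly_mul (poly_const c) Hg.
elim: e => [n|i||a IHa|a IHa b IHb|a IHa b IHb|a IHa b IHb] /=.
- exact: poly_const.
- exact: poly_add (lin _ _ poly_id) (poly_const _).
- exact: poly_add (lin _ _ poly_id) (poly_const _).
- exact: poly_add (poly_add (poly_add IHa (lin _ _ poly_id)) (lin _ _ (pv a))) (poly_const _).
- exact: poly_add (poly_add IHa IHb) (poly_const _).
- exact: poly_add (poly_add (poly_add (poly_add IHa IHb) (lin _ _ (pv a))) (lin _ _ (pv b))) (poly_const _).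
- apply: poly_add (poly_add IHa (poly_mul (pv a) (poly_add _ (poly_const _)))) (poly_const _).
  exact: (poly_comp (g := time_bound b) IHb (poly_add poly_id (pv a))).
Qed.

Lemma eval_le x env e N : size x <= N -> (forall i, env i <= N) ->
  eval x env e <= value_bound e N.
Proof.
elim: e env N => [n|i||a IHa|a IHa b IHb|a IHa b IHb|a IHa b IHb] env N xN eN //=.
- by case: nth.
- by rewrite leq_add ?IHa ?IHb.
- by apply: leq_trans (leq_subr _ _) _; apply: IHa.
- have le_a := IHa _ _ xN eN.
  apply: (@leq_trans (\sum_(i < eval x env a) value_bound b (N + value_bound a N))).
    apply: leq_sum => i _; apply: IHb; first exact: leq_trans (leq_addr _ _).
    case=> [|j] /=; last exact: leq_trans (leq_addr _ _).
    by apply: leq_trans (leq_addl _ _); apply: leq_trans (ltnW (ltn_ord i)) le_a.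
  by rewrite sum_nat_const card_ord leq_mul2r le_a orbT.
Qed.

(** Stacks 0, 1 and 2 are reserved for output, input and scratch, so variables live above 2 and
    below the free region. A variable without a stack must be 0, because [comp] emits nothing for
    it. *)
Record ready (x : seq bool) (env : nat -> nat) (vs : seq nat) (l : nat) (st : store) : Prop := Ready {
  ready_l : 2 < l;
  ready_vs : forall i, i < size vs -> 2 < nth 0 vs i < l;
  ready_input : st 1 = x;
  ready_scratch : st 2 = [::];
  ready_free : forall j, l <= j -> st j = [::];
  ready_vars : forall i, i < size vs -> st (nth 0 vs i) = nseq (env i) true;
  ready_env : forall i, size vs <= i -> env i = 0
}.

Definition add_to (st : store) (r n : nat) : store := upd st r (nseq n true ++ st r).

Lemma add_to0 st r : add_to st r 0 = st.
Proof.
by apply: functional_extensionality => k; rewrite /add_to /upd; case: eqP => // ->.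
Qed.

Lemma add_to_add st r m n : add_to (add_to st r m) r n = add_to st r (m + n).
Proof.
apply: functional_extensionality => k; rewrite /add_to /upd eqxx; case: eqP => // _.
by rewrite catA -nseqD addnC.
Qed.

Lemma ready_add_to x env vs l st r n : ready x env vs l st ->
  r < l -> r != 1 -> r != 2 -> r \notin vs -> ready x env vs l (add_to st r n).
Proof.
move=> [l2 hvs h1 h2 hf hv he] rl r1 r2 rvs; split=> // [||j lj|i iv];
  rewrite /add_to upd_other //; try by rewrite eq_sym.
- exact: hf.
- by apply/eqP => e; move: lj; rewrite e leqNgt rl.
- exact: hv.
- by apply: contraNneq rvs => <-; apply: mem_nth.
Qed.

Lemma ready_fresh x env vs l st n : ready x env vs l st ->
  ready x env vs l.+1 (add_to st l n).
Proof.
move=> [l2 hvs h1 h2 hf hv he]; split=> // [|i iv|||j lj|i iv].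
- exact: leqW.
- by case/andP: (hvs i iv) => -> /=; apply: leqW.
- by rewrite /add_to upd_other //; apply/eqP; lia.
- by rewrite /add_to upd_other //; apply/eqP; lia.
- by rewrite /add_to upd_other ?hf //; [apply: ltnW | apply/eqP; lia].
- rewrite /add_to upd_other ?hv //; apply/eqP; have := hvs i iv; lia.
Qed.

Lemma cost_add_const st r n :
  cost (iter n (Seq (Push r true)) Skip) st (add_to st r n) (2 * n + 1).
Proof.
elim: n st => [|n IH] st /=; first by rewrite add_to0; apply: cost_skip.
have := cost_seq (cost_push st r true) (IH _).
rewrite -[upd _ _ _]/(add_to st r 1) add_to_add => H.
by apply: cost_le H _; lia.
Qed.

Lemma cost_eq c st st' st'' T : cost c st st' T -> st' = st'' -> cost c st st'' T.
Proof. by move=> ? <-. Qed.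

Lemma rev_nseq_true n : rev (nseq n true) = nseq n true :> seq bool.
Proof.
by apply: (@eq_from_nth _ false); rewrite size_rev ?size_nseq // => i iN;
  rewrite nth_rev ?size_nseq // !nth_nseq; do 2! case: ifP => //; lia.
Qed.

Lemma add_to_comm st l r m n : l != r ->
  add_to (add_to st l m) r n = add_to (add_to st r n) l m.
Proof.
move=> lr; apply: functional_extensionality => k; rewrite /add_to /upd.
by rewrite [r == l]eq_sym (negbTE lr); case: eqP => // ->; rewrite eq_sym (negbTE lr).
Qed.

Lemma add_to_at st l m : st l = [::] -> add_to st l m l = nseq m true.
Proof. by move=> E; rewrite /add_to upd_same E cats0. Qed.

Lemma add_to_other st l m k : k != l -> add_to st l m k = st k.
Proof. by move=> kl; rewrite /add_to upd_other. Qed.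

Lemma upd_add_to st l m n : st l = [::] -> upd (add_to st l m) l (nseq n true) = add_to st l n.
Proof.
move=> E; apply: functional_extensionality => k; rewrite /add_to /upd.
by case: eqP => // _; rewrite E cats0.
Qed.

Lemma cost_copy v r st n : v != r -> v != 2 -> r != 2 -> st 2 = [::] -> st v = nseq n true ->
  cost (Seq (drain v [:: 2] [::]) (drain 2 [:: v; r] [::])) st (add_to st r n) (20 * n + 20).
Proof.
move=> vr v2 r2 s2 sv.
apply: cost_eq; first apply: cost_le (cost_seq (cost_drain _ _ _) (cost_drain _ _ _)) _ => //=.
- by rewrite inE.
- by rewrite inE vr.
- by rewrite !inE negb_or ![2 == _]eq_sym v2 r2.
- rewrite /drained !inE eqxx [2 == v]eq_sym (negbTE v2) s2 sv cats0 size_rev size_nseq; lia.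
apply: functional_extensionality => k; rewrite /drained /add_to /upd !inE.
rewrite eqxx [2 == v]eq_sym (negbTE v2) s2 sv cats0 !rev_nseq_true.
case: (eqVneq k 2) => [->|k2]; first by rewrite [2 == r]eq_sym (negbTE r2) s2.
case: (eqVneq k v) => [->|kv] /=; first by rewrite (negbTE vr) cats0 sv.
by case: eqP => // ->.
Qed.

Lemma cost_flush l r st n : l != r -> st l = [::] ->
  cost (drain l [:: r] [::]) (add_to st l n) (add_to st r n) (6 * n + 1).
Proof.
move=> lr sl; apply: cost_eq; first apply: cost_le (cost_drain _ _ _) _ => //=.
- by rewrite inE.
- by rewrite add_to_at // size_nseq; lia.
apply: functional_extensionality => k; rewrite /drained /add_to /upd !inE eqxx sl cats0 rev_nseq_true.
case: (eqVneq k l) => [->|kl]; first by rewrite (negbTE lr) sl.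
by case: eqP => // ->.
Qed.

Lemma cost_clear l st n : st l = [::] ->
  cost (drain l [::] [::]) (add_to st l n) st (4 * n + 1).
Proof.
move=> sl; apply: cost_eq; first apply: cost_le (cost_drain _ _ _) _ => //=.
- by rewrite add_to_at // size_nseq; lia.
apply: functional_extensionality => k; rewrite /drained /add_to /upd /=.
by case: eqP => // ->.
Qed.

Lemma cost_length r st x : r != 1 -> r != 2 -> st 1 = x -> st 2 = [::] ->
  cost (Seq (drain 1 [:: 2] [:: r]) (drain 2 [:: 1] [::])) st (add_to st r (size x)) (20 * size x + 20).
Proof.
move=> r1 r2 s1 s2.
apply: cost_eq; first apply: cost_le (cost_seq (cost_drain _ _ _) (cost_drain _ _ _)) _ => //=.
- by rewrite !inE andbT eq_sym.
- by rewrite !inE negb_or /= eq_sym.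
- by rewrite /drained !inE /= s1 s2 cats0 size_rev; lia.
apply: functional_extensionality => k; rewrite /drained /add_to /upd !inE /= s1 s2 cats0 revK.
case: (eqVneq k 2) => [->|k2]; first by rewrite [2 == r]eq_sym (negbTE r2) s2.
case: (eqVneq k 1) => [->|k1] /=; first by rewrite [1 == r]eq_sym (negbTE r1) cats0 s1.
by case: eqP => // ->.
Qed.

(** Popping an empty stack changes nothing, which is exactly the truncation of the subtraction. *)
Lemma cost_sub l st m n : st l = [::] -> st l.+1 = [::] ->
  cost (Loop l.+1 Skip (IfPop l Skip Skip Skip))
    (add_to (add_to st l m) l.+1 n) (add_to st l (m - n)) (3 * n + 1).
Proof.
move=> sl sl1.
have ll : l != l.+1 by rewrite neq_ltn ltnSn.
pose I j := add_to (add_to st l (m - j)) l.+1 (n - j).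
have E j : add_to st l j l.+1 = [::] by rewrite add_to_other // eq_sym.
have -> : add_to st l (m - n) = I (size (nseq n true)).
  by rewrite /I size_nseq subnn add_to0.
have {1}-> : add_to (add_to st l m) l.+1 n = I 0 by rewrite /I !subn0.
apply: cost_le (cost_loop (B := 2) _ _) _ => [j jn|j jn|]; rewrite ?size_nseq; last by lia.
  by rewrite /I add_to_at // drop_nseq.
rewrite size_nseq in jn; rewrite nth_nseq jn drop_nseq /I upd_add_to //.
have sub : m - j.+1 = (m - j).-1 by lia.
case Em : (m - j) => [|p].
  apply: cost_ifpop_nil; first by rewrite add_to_other // add_to0.
  by rewrite sub Em /=; apply: cost_skip.
apply: (@cost_ifpop_cons _ _ _ _ _ _ _ true (nseq p true)).
  by rewrite add_to_other // add_to_at.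
have -> : upd (add_to (add_to st l p.+1) l.+1 (n - j.+1)) l (nseq p true) = add_to (add_to st l (m - j.+1)) l.+1 (n - j.+1).
  rewrite add_to_comm // upd_add_to; last by rewrite add_to_other.
  by rewrite -add_to_comm // sub Em.
exact: cost_skip.
Qed.

(** Stack [l] counts the passes left and may hold anything as far as the body is concerned; stack
    [l.+1] holds the bound variable and comes first in [vs], as index 0. *)
Lemma ready_bind x env vs l st j m : ready x env vs l st ->
  ready x (scons j env) (l.+1 :: vs) l.+2 (add_to (add_to st l.+1 j) l m).
Proof.
move=> [l2 hvs h1 h2 hf hv he]; split=> [|[|i] iv|||k lk|[|i] iv|[|i] iv] //=.
- by lia.
- by lia.
- by have := hvs i iv; lia.
- by rewrite !add_to_other //; lia.
- by rewrite !add_to_other //; lia.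
- by rewrite !add_to_other ?hf //; lia.
- by rewrite add_to_other ?add_to_at ?hf //; lia.
- by have B := hvs i iv; rewrite !add_to_other ?hv //; lia.
- exact: he.
Qed.

(** Every pass over an input bit takes one unit off stack [l]. With [n.+1] units at the start,
    position [n] is the one that removes the last unit, which differs from finding the stack already
    empty. On a bit 1 a second pop tests for this; if it succeeds, the unit is put back. [hit j] is
    the contribution of the first [j] positions. *)
Lemma cost_bit l r st x n : l != r -> 2 < l -> r != 1 -> r != 2 ->
  st l = [::] -> st 1 = x -> st 2 = [::] ->
  cost
    (Seq (Loop 1
           (Seq (Push 2 false) (IfPop l Skip Skip Skip))
           (Seq (Push 2 true)
              (IfPop l Skip Skip (IfPop l (Push r true) Skip (Push l true)))))
        (Seq (drain 2 [:: 1] [::]) (drain l [::] [::])))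
    (add_to st l n.+1) (add_to st r (nth false x n)) (20 * size x + 20 * n + 30).
Proof.
move=> lr l2 r1 r2 sl s1 s2.
have l1' : l != 1 by lia.
have l2' : l != 2 by lia.
pose I0 j q p := upd (upd (add_to (add_to st r q) l p) 1 (drop j x)) 2 (rev (take j x)).
pose hit j : nat := if n < j then nat_of_bool (nth false x n) else 0.
pose I j := I0 j (hit j) (n.+1 - j).
have I0l j q p : I0 j q p l = nseq p true.
  by rewrite /I0 !upd_other // add_to_at // add_to_other.
have I0upd j q p p' : upd (I0 j q p) l (nseq p' true) = I0 j q p'.
  apply: functional_extensionality => k; rewrite /I0 /upd.
  case: (eqVneq k l) => [->|kl]; first by rewrite (negbTE l1') (negbTE l2') add_to_at // add_to_other.
  by case: eqP => // _; case: eqP => // _; rewrite !(@add_to_other _ l).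
have I0push j q p : add_to (I0 j q p) r 1 = I0 j q.+1 p.
  apply: functional_extensionality => k; rewrite /I0 /add_to /upd.
  rewrite (negbTE r1) (negbTE r2) eqxx [r == l]eq_sym (negbTE lr).
  case: (eqVneq k r) => [->|kr]; rewrite ?(negbTE r1) ?(negbTE r2) ?[r == l]eq_sym ?(negbTE lr) //.
have body j q p : j < size x ->
    upd (upd (I0 j q p) 1 (drop j.+1 x)) 2 (nth false x j :: upd (I0 j q p) 1 (drop j.+1 x) 2)
    = I0 j.+1 q p.
  move=> jx; apply: functional_extensionality => k; rewrite /I0 /upd /=.
  case: (eqVneq k 2) => [_|k2]; first by rewrite (take_nth false jx) rev_rcons.
  by case: eqP.
have start : add_to st l n.+1 = I 0.
  apply: functional_extensionality => k; rewrite /I /I0 /hit /= add_to0 subn0 drop0 take0 /upd.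
  case: (eqVneq k 2) => [->|k2]; first by rewrite add_to_other // eq_sym.
  by case: (eqVneq k 1) => [->|k1] //; rewrite add_to_other // eq_sym.
have hit_far j : n != j -> hit j.+1 = hit j.
  by move=> nj; rewrite /hit ltnS leq_eqVlt (negbTE nj).
have drop_p j p : n.+1 - j = p.+1 -> n - j = p by lia.
have loop : cost (Loop 1
           (Seq (Push 2 false) (IfPop l Skip Skip Skip))
           (Seq (Push 2 true)
              (IfPop l Skip Skip (IfPop l (Push r true) Skip (Push l true)))))
        (I 0) (I (size x)) (size x * 7 + 1).
  apply: cost_loop => [j _|j jx]; first by rewrite /I /I0 upd_other // upd_same.
  have := body j (hit j) (n.+1 - j) jx; case Eb: (nth false x j) => bodyE.
    apply: cost_le (cost_seq (cost_push _ _ _) (T2 := 3) _) _ => //; rewrite bodyE /I subSS.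
    case Ep: (n.+1 - j) => [|p].
      apply: cost_ifpop_nil; first by rewrite I0l.
      rewrite (_ : n - j = 0) ?hit_far; [|lia..].
      by apply: cost_le (cost_skip _) _.
    apply: (@cost_ifpop_cons _ _ _ _ _ _ _ true (nseq p true)); first by rewrite I0l.
    rewrite I0upd (drop_p _ _ Ep); case: p Ep => [|p] Ep.
      have nj : n = j by lia.
      apply: cost_ifpop_nil; first by rewrite I0l.
      apply: cost_eq (cost_push _ _ _) _; rewrite -[upd _ _ _]/(add_to _ r 1) I0push.
      by rewrite /hit nj ltnn ltnSn Eb.
    apply: (@cost_ifpop_cons _ _ _ _ _ _ _ true (nseq p true)); first by rewrite I0l.
    rewrite I0upd; apply: cost_eq (cost_push _ _ _) _.
    by rewrite I0l -[_ :: _]/(nseq p.+1 true) I0upd hit_far //; lia.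
  apply: cost_le (cost_seq (cost_push _ _ _) (T2 := 2) _) _ => //; rewrite bodyE /I subSS.
  have -> : hit j.+1 = hit j.
    case: (eqVneq n j) => [nj|]; last exact: hit_far.
    by rewrite /hit nj ltnn ltnSn Eb.
  case Ep: (n.+1 - j) => [|p].
    apply: cost_ifpop_nil; first by rewrite I0l.
    rewrite (_ : n - j = 0); last by lia.
    exact: cost_skip.
  apply: (@cost_ifpop_cons _ _ _ _ _ _ _ true (nseq p true)); first by rewrite I0l.
  by rewrite I0upd (drop_p _ _ Ep); apply: cost_skip.
rewrite start.
apply: cost_eq; first apply: (cost_le (cost_seq loop (cost_seq (cost_drain _ _ _) (cost_drain _ _ _)))) => //=.
  rewrite /drained (negbTE l2') inE (negbTE l1') /I !I0l size_nseq.
  by rewrite /I0 upd_same size_rev take_size; lia.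
apply: functional_extensionality => k; rewrite /drained /I /I0 /= !inE.
case: (eqVneq k l) => [->|kl]; first by rewrite add_to_other.
case: (eqVneq k 2) => [->|k2]; first by rewrite add_to_other // eq_sym.
case: (eqVneq k 1) => [->|k1].
  by rewrite /upd /= drop_size take_size revK cats0 add_to_other // eq_sym.
rewrite !upd_other // [add_to _ l _ k]add_to_other // /hit.
by case: ltnP => // xn; rewrite nth_default.
Qed.

Lemma ready_notin x env vs l st i : ready x env vs l st -> l <= i -> i \notin vs.
Proof.
move=> R li; apply/negP => /(nthP 0)[j jv e].
by have := ready_vs R jv; rewrite e [i < l]ltnNge li andbF.
Qed.

Lemma comp_correct e x env vs l r st N :
  ready x env vs l st -> r < l -> r != 1 -> r != 2 -> r \notin vs ->
  size x <= N -> (forall i, env i <= N) ->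
  cost (comp vs l r e) st (add_to st r (eval x env e)) (time_bound e N).
Proof.
elim: e env vs l r st N => [n|i||a IHa|a IHa b IHb|a IHa b IHb|a IHa b IHb]
  env vs l r st N R rl r1 r2 rvs xN eN /=.
- exact: cost_add_const.
- case: ifP => [iv|/negbT]; last first.
    rewrite -leqNgt => iv; rewrite (ready_env R iv) add_to0.
    by apply: cost_le (cost_skip _) _; lia.
  have vr : nth 0 vs i != r by apply: contraNneq rvs => <-; apply: mem_nth.
  have v2 := ready_vs R iv.
  apply: cost_le (cost_copy vr _ r2 (ready_scratch R) (ready_vars R iv)) _; first by lia.
  by have := eN i; lia.
- apply: cost_le (cost_length r1 r2 (ready_input R) (ready_scratch R)) _; lia.
all: have l2 := ready_l R; have sl := ready_free R (leqnn l).
all: have sl1 := ready_free R (leqnSn l).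
all: have lvs := ready_notin R.
all: have va := eval_le a xN eN.
all: have Hl : cost (comp vs l.+1 l a) st (add_to st l (eval x env a)) (time_bound a N).
all: try by apply: IHa => //; [have := ready_fresh 0 R; rewrite add_to0 | lia | lia | exact: lvs].
- have Hl' : cost (comp vs l.+1 l a) (add_to st l 1) (add_to st l (1 + eval x env a)) (time_bound a N).
    rewrite -add_to_add; apply: IHa => //; [exact: ready_fresh | lia | lia | exact: lvs].
  have lr : l != r by lia.
  have Hb := cost_bit (eval x env a) lr l2 r1 r2 sl (ready_input R) (ready_scratch R).
  have Hp : cost (Push l true) st (add_to st l 1) 1 by apply: cost_push.
  by apply: cost_le (cost_seq Hp (cost_seq Hl' Hb)) _; lia.
- have Ha := IHa _ _ _ _ _ _ R rl r1 r2 rvs xN eN.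
  have Hb := IHb _ _ _ _ _ _ (ready_add_to (eval x env a) R rl r1 r2 rvs) rl r1 r2 rvs xN eN.
  by rewrite add_to_add in Hb; apply: cost_le (cost_seq Ha Hb) _; lia.
- have vb := eval_le b xN eN.
  have H2 : cost (comp vs l.+2 l.+1 b) (add_to st l (eval x env a))
     (add_to (add_to st l (eval x env a)) l.+1 (eval x env b)) (time_bound b N).
    apply: IHb => //; try lia; last exact: lvs.
    by have := ready_fresh 0 (ready_fresh (eval x env a) R); rewrite add_to0.
  have lr : l != r by lia.
  have H3 := cost_sub (eval x env a) (eval x env b) sl sl1.
  have H4 := cost_flush (eval x env a - eval x env b) lr sl.
  by apply: cost_le (cost_seq Hl (cost_seq H2 (cost_seq H3 H4))) _; lia.
- set n := eval x env a in Hl va *.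
  pose f i := eval x (scons i env) b.
  pose I j := add_to (add_to (add_to st r (\sum_(i < j) f i)) l.+1 j) l (n - j).
  have Rr q : ready x env vs l (add_to st r q) by apply: ready_add_to.
  have fl q j : add_to (add_to st r q) l.+1 j l = [::].
    by rewrite !add_to_other //; lia.
  pose N' := N + value_bound a N.
  have loop : cost (Loop l Skip (Seq (comp (l.+1 :: vs) l.+2 r b) (Push l.+1 true)))
      (I 0) (I (size (nseq n true))) (n * (time_bound b N' + 5) + 1).
    apply: cost_le (cost_loop (B := time_bound b N' + 2) _ _) _ => [j jn|j jn|].
    + by rewrite /I add_to_at // drop_nseq.
    + rewrite size_nseq in jn; rewrite nth_nseq jn drop_nseq /I upd_add_to //.
      have Hb : cost (comp (l.+1 :: vs) l.+2 r b)
          (add_to (add_to (add_to st r (\sum_(i < j) f i)) l.+1 j) l (n - j.+1))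
          (add_to (add_to (add_to (add_to st r (\sum_(i < j) f i)) l.+1 j) l (n - j.+1)) r (f j))
          (time_bound b N').
        apply: IHb => //.
        * exact: ready_bind.
        * by lia.
        * by rewrite inE negb_or rvs andbT; lia.
        * by lia.
        * by case=> [|i] /=; [lia | have := eN i; lia].
      apply: cost_eq; first apply: cost_le (cost_seq Hb (cost_push _ _ _)) _; first by lia.
      rewrite -[upd _ _ _]/(add_to _ l.+1 1) big_ord_recr /=.
      rewrite (@add_to_comm _ l r); last by lia.
      rewrite (@add_to_comm _ l.+1 r); last by lia.
      rewrite add_to_add (@add_to_comm _ l l.+1); last by lia.
      by rewrite add_to_add addn1.
    + by rewrite size_nseq; nia.
  have I_end : I (size (nseq n true)) = add_to (add_to st r (\sum_(i < n) f i)) l.+1 n.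
    by rewrite /I size_nseq subnn add_to0.
  have I_start : I 0 = add_to st l n by rewrite /I big_ord0 !add_to0 subn0.
  rewrite I_end I_start in loop.
  apply: cost_le (cost_seq Hl (cost_seq loop (cost_clear _ _))) _.
    by rewrite add_to_other //; lia.
  have : n * (time_bound b N' + 5) <= value_bound a N * (time_bound b N' + 5) by rewrite leq_mul2r va orbT.
  rewrite /N'; nia.
Qed.

(** * Definable functions *)

Definition definable (f : seq bool -> (nat -> nat) -> nat) : Prop :=
  exists e, forall x env, eval x env e = f x env.

Definition env0 : nat -> nat := fun _ => 0.

(** Stack 3 counts the output bits still to come, stack 4 holds the current position and stack 5 the
    value computed for it. Stack 0 is free for the output once the input has moved to stack 1, which
    also puts its first bit on top. *)
Definition emit (len bit : expr) : cmd :=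
  Seq (drain 0 [:: 1] [::]) (Seq (comp [::] 4 3 len) (Seq
    (Loop 3 Skip
      (Seq (comp [:: 4] 6 5 bit) (Seq
        (IfPop 5 (Push 0 false) (Push 0 true) (Push 0 true)) (Seq
        (drain 5 [::] [::]) (Push 4 true)))))
    Skip)).

Theorem definable_poly_time (len bit : seq bool -> (nat -> nat) -> nat) :
  definable len -> definable bit ->
  poly_time_computable
    (fun x => mkseq (fun i => bit x (scons i env0) != 0) (len x env0)).
Proof.
move=> [el Hl] [eb Hb].
pose vl n := value_bound el n.
pose tb n := time_bound eb (n + vl n).
pose vb n := value_bound eb (n + vl n).
apply: (@program_poly_time (emit el eb) _
  (fun n => 20 * n + 20 + time_bound el n + vl n * (tb n + 20 * vb n + 30))).
  have pc := poly_const; have pN := poly_add poly_id (poly_value_bound el).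
  have pt := poly_comp (poly_time_bound eb) pN; have pv := poly_comp (poly_value_bound eb) pN.
  apply: poly_add.
    exact: poly_add (poly_add (poly_mul (pc 20) poly_id) (pc 20)) (poly_time_bound el).
  apply: poly_mul (poly_value_bound el) _.
  exact: poly_add (poly_add pt (poly_mul (pc 20) pv)) (pc 30).
move=> x; set n := len x env0.
pose out j := [seq bit x (scons i env0) != 0 | i <- iota 0 j].
pose s1 : store := upd (fun _ => [::]) 1 x.
have R1 : ready x env0 [::] 4 (add_to s1 3 0).
  rewrite add_to0; split=> // j j4; rewrite /s1 upd_other //; lia.
exists (upd (add_to s1 4 n) 0 (rev (out n))); last by rewrite upd_same revK.
have H1 : cost (drain 0 [:: 1] [::]) (start_store x) s1 (6 * size x + 1).
  apply: cost_eq; first apply: cost_le (cost_drain _ _ _) _ => //=.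
    by rewrite size_rev; lia.
  by apply: functional_extensionality => -[|[|k]]; rewrite /drained /s1 /upd //= revK cats0.
have H2 : cost (comp [::] 4 3 el) s1 (add_to s1 3 n) (time_bound el (size x)).
  rewrite /n -Hl -[in X in cost _ X](add_to0 s1 3) -[in X in cost _ _ X _](add_to0 s1 3).
  exact: comp_correct.
have vn : n <= vl (size x) by rewrite /n -Hl; apply: eval_le.
pose I j := upd (add_to (add_to s1 3 (n - j)) 4 j) 0 (rev (out j)).
pose B := tb (size x) + 6 * vb (size x) + 20.
have H3 : cost (Loop 3 Skip
      (Seq (comp [:: 4] 6 5 eb) (Seq
        (IfPop 5 (Push 0 false) (Push 0 true) (Push 0 true)) (Seq
        (drain 5 [::] [::]) (Push 4 true)))))
   (I 0) (I (size (nseq n true))) (n * B.+1 + 1).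
  rewrite -{2}(size_nseq n true); apply: cost_loop => [j jn|j].
    by rewrite /I upd_other // add_to_other // add_to_at // drop_nseq.
  rewrite size_nseq => jn; rewrite nth_nseq jn drop_nseq.
  set S := upd (I j) 3 _.
  have ES : S = upd (add_to (add_to s1 3 (n - j.+1)) 4 j) 0 (rev (out j)).
    apply: functional_extensionality => k; rewrite /S /I /add_to /upd.
    by case: (eqVneq k 3) => [->|k3] //=; rewrite cats0.
  have RS : ready x (scons j env0) [:: 4] 6 S.
    rewrite ES; split=> //.
    - by case.
    - by move=> k k6; rewrite /add_to /s1 !upd_other //; lia.
    - by case=> [|i] //= _; rewrite upd_other // add_to_at.
    - by case.
  have jv : j <= vl (size x) by apply: leq_trans (ltnW jn) vn.
  have eN i : scons j env0 i <= size x + vl (size x) by case: i => [|i] //=; lia.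
  have xN : size x <= size x + vl (size x) by lia.
  have Hc := @comp_correct eb x _ [:: 4] 6 5 S (size x + vl (size x)) RS isT isT isT isT xN eN.
  have vbE := eval_le eb xN eN.
  have S5 : S 5 = [::] by rewrite ES /add_to /s1 !upd_other.
  set v := eval x (scons j env0) eb in Hc vbE.
  pose S0 := upd S 0 ((v != 0) :: S 0).
  have Hif : cost (IfPop 5 (Push 0 false) (Push 0 true) (Push 0 true))
      (add_to S 5 v) (add_to S0 5 v.-1) 2.
    (* The pop that tests [v] also removes one unit, so [v.-1] units are left to be cleared. *)
    case Ev : v => [|v'].
      apply: cost_ifpop_nil; first by rewrite add_to_at.
      by rewrite !add_to0 /S0 Ev; apply: cost_push.
    apply: (@cost_ifpop_cons _ _ _ _ _ _ _ true (nseq v' true)); first by rewrite add_to_at.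
    rewrite upd_add_to //; apply: cost_eq (cost_push _ _ _) _; rewrite /S0 Ev.
    by apply: functional_extensionality => k; rewrite /add_to /upd /=; case: (eqVneq k 5) => [->|].
  have S05 : S0 5 = [::] by rewrite /S0 upd_other.
  apply: cost_eq.
    apply: cost_le (cost_seq Hc (cost_seq Hif (cost_seq (cost_clear v.-1 S05) (cost_push _ _ _)))) _.
    by rewrite /B -/(tb _) -/(vb _) in vbE *; lia.
  have outS : out j.+1 = rcons (out j) (v != 0).
    by rewrite /out -addn1 iotaD map_cat /= cats1 /v Hb.
  apply: functional_extensionality => k; rewrite /S0 ES /I /add_to /upd outS rev_rcons.
  by case: (eqVneq k 4) => [ek|k4]; case: (eqVneq k 0) => [ek0|k0] //=; rewrite ?ek //; lia.
rewrite size_nseq in H3.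
have I_start : I 0 = add_to s1 3 n.
  by apply: functional_extensionality => k; rewrite /I subn0 add_to0 /upd; case: eqP => // ->.
have I_end : I n = upd (add_to s1 4 n) 0 (rev (out n)) by rewrite /I subnn add_to0.
rewrite I_start I_end in H3.
apply: cost_le (cost_seq H1 (cost_seq H2 (cost_seq H3 (cost_skip _)))) _.
have : n * B.+1 <= vl (size x) * B.+1 by rewrite leq_mul2r vn orbT.
rewrite /B; nia.
Qed.

Lemma definable_const c : definable (fun _ _ => c).
Proof. by exists (Const c). Qed.

Lemma definable_var i : definable (fun _ env => env i).
Proof. by exists (Var i). Qed.

Lemma definable_size : definable (fun x _ => size x).
Proof. by exists Len. Qed.

Lemma definable_ext f g : (forall x env, f x env = g x env) -> definable f -> definable g.
Proof. by move=> fg [e H]; exists e => x env; rewrite H. Qed.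

Fixpoint rename (s : nat -> nat) (e : expr) : expr :=
  match e with
  | Const n => Const n
  | Var i => Var (s i)
  | Len => Len
  | Bit a => Bit (rename s a)
  | Add a b => Add (rename s a) (rename s b)
  | Monus a b => Monus (rename s a) (rename s b)
  | Sum a b => Sum (rename s a) (rename (fun i => if i is i'.+1 then (s i').+1 else 0) b)
  end.

Lemma eval_rename x e : forall s env, eval x env (rename s e) = eval x (fun i => env (s i)) e.
Proof.
elim: e => [n|i||a IHa|a IHa b IHb|a IHa b IHb|a IHa b IHb] s env //=; rewrite ?IHa ?IHb //.
apply: eq_bigr => i _; rewrite IHb; congr (eval x _ b).
by apply: functional_extensionality => -[|j].
Qed.

Lemma definable_shift f : definable f -> definable (fun x env => f x (fun j => env j.+1)).
Proof. by move=> [e H]; exists (rename S e) => x env; rewrite eval_rename H. Qed.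

(** * Closure properties of definable functions *)

Section Closure.
Implicit Types a b : seq bool -> (nat -> nat) -> nat.
Implicit Types p q : seq bool -> (nat -> nat) -> bool.

Lemma definable_add a b : definable a -> definable b ->
  definable (fun x env => a x env + b x env).
Proof. by move=> [ea Ha] [eb Hb]; exists (Add ea eb) => x env /=; rewrite Ha Hb. Qed.

Lemma definable_sub a b : definable a -> definable b ->
  definable (fun x env => a x env - b x env).
Proof. by move=> [ea Ha] [eb Hb]; exists (Monus ea eb) => x env /=; rewrite Ha Hb. Qed.

Lemma definable_succ a : definable a -> definable (fun x env => (a x env).+1).
Proof.
move=> da; apply: definable_ext (definable_add da (definable_const 1)) => x env.
by rewrite addn1.
Qed.

Lemma definable_bit a : definable a ->
  definable (fun x env => nat_of_bool (nth false x (a x env))).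
Proof. by move=> [ea Ha]; exists (Bit ea) => x env /=; rewrite Ha. Qed.

(** Under the binder the index is variable 0 and the outer variables are shifted up; the second
    premise describes the summand in that environment. *)
Lemma definable_sum a (g : seq bool -> (nat -> nat) -> nat -> nat) : definable a ->
  definable (fun x env => g x (fun j => env j.+1) (env 0)) ->
  definable (fun x env => \sum_(0 <= i < a x env) g x env i).
Proof.
move=> [ea Ha] [eg Hg]; exists (Sum ea eg) => x env /=; rewrite Ha big_mkord.
by apply: eq_bigr => i _; rewrite Hg.
Qed.

Lemma definable_mul a b : definable a -> definable b ->
  definable (fun x env => a x env * b x env).
Proof.
move=> da db; apply: definable_ext (definable_sum (g := fun x env _ => b x env) da _) => [x env|].
  by rewrite sum_nat_const_nat subn0.
exact: definable_shift.
Qed.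

Lemma definable_exp a k : definable a -> definable (fun x env => a x env ^ k).
Proof.
move=> da; elim: k => [|k IH]; first exact: (definable_const 1).
by apply: definable_ext (definable_mul da IH) => x env; rewrite expnS.
Qed.

Lemma definable_polybound a k : definable a -> definable (fun x env => polybound k (a x env)).
Proof.
move=> da; apply: definable_add (definable_const k).
exact: definable_mul (definable_const k) (definable_exp k da).
Qed.

Lemma definable_not p : definable p -> definable (fun x env => ~~ p x env).
Proof.
move=> dp; apply: definable_ext (definable_sub (definable_const 1) dp) => x env.
by case: (p x env).
Qed.

Lemma definable_and p q : definable p -> definable q ->
  definable (fun x env => p x env && q x env).
Proof.
move=> dp dq; apply: definable_ext (definable_mul dp dq) => x env.
by case: (p x env); case: (q x env).
Qed.

Lemma definable_or p q : definable p -> definable q ->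
  definable (fun x env => p x env || q x env).
Proof.
move=> dp dq.
apply: definable_ext (definable_not (definable_and (definable_not dp) (definable_not dq))) => x env.
by case: (p x env); case: (q x env).
Qed.

Lemma definable_leq a b : definable a -> definable b ->
  definable (fun x env => a x env <= b x env).
Proof.
move=> da db; apply: definable_ext (definable_sub (definable_const 1) (definable_sub da db)) => x env.
by rewrite /leq; case: (a x env - b x env) => // n; rewrite subSS sub0n.
Qed.

Lemma definable_eqn a b : definable a -> definable b ->
  definable (fun x env => a x env == b x env).
Proof.
move=> da db; apply: definable_ext (definable_and (definable_leq da db) (definable_leq db da)) => x env.
by rewrite eqn_leq.
Qed.

Lemma definable_eqb p q : definable p -> definable q ->
  definable (fun x env => p x env == q x env).
Proof.
move=> da db; apply: definable_ext (definable_eqn da db) => x env.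
by case: (p x env); case: (q x env).
Qed.

Lemma definable_if p a b : definable p -> definable a -> definable b ->
  definable (fun x env => if p x env then a x env else b x env).
Proof.
move=> dp da db.
apply: definable_ext (definable_add (definable_mul dp da) (definable_mul (definable_not dp) db)) => x env.
by case: (p x env); rewrite ?mul1n ?mul0n ?addn0.
Qed.

Lemma definable_ifb p q (r : seq bool -> (nat -> nat) -> bool) : definable p -> definable q -> definable r ->
  definable (fun x env => nat_of_bool (if p x env then q x env else r x env)).
Proof.
by move=> dp dq dr; apply: definable_ext (definable_if dp dq dr) => x env; case: (p x env).
Qed.

Lemma definable_exists a (r : seq bool -> (nat -> nat) -> nat -> bool) : definable a ->
  definable (fun x env => r x (fun j => env j.+1) (env 0)) ->
  definable (fun x env => has (fun i => r x env i) (iota 0 (a x env))).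
Proof.
move=> da dr; apply: definable_ext (definable_not (definable_eqn
  (definable_sum (g := fun x env i => nat_of_bool (r x env i)) da dr) (definable_const 0))) => x env.
congr nat_of_bool; rewrite /index_iota subn0 sum_nat_seq_eq0 -has_predC.
by apply: eq_has => i /=; case: (r x env i).
Qed.

Lemma definable_forall a (r : seq bool -> (nat -> nat) -> nat -> bool) : definable a ->
  definable (fun x env => r x (fun j => env j.+1) (env 0)) ->
  definable (fun x env => all (fun i => r x env i) (iota 0 (a x env))).
Proof.
move=> da dr; apply: definable_ext (definable_not (definable_exists
  (r := fun x env i => ~~ r x env i) da (definable_not dr))) => x env.
by congr nat_of_bool; rewrite -all_predC; apply: eq_all => i /=; rewrite negbK.
Qed.

(** The quotient counts the positive multiples of [d] up to [m], and none of their factors exceeds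
    [m]. *)
Lemma divn_sum m d : 0 < d -> m %/ d = \sum_(0 <= i < m) (i.+1 * d <= m).
Proof.
move=> d0; have le : m %/ d <= m by apply: leq_div.
rewrite (big_cat_nat _ le) //= [X in _ + X]big_nat [X in _ + X]big1 ?addn0.
  rewrite big_nat (eq_bigr (fun _ => 1)) -?big_nat ?sum_nat_const_nat ?subn0 ?muln1 // => i /andP[_ im].
  by rewrite -leq_divRL // im.
by move=> i /andP[mi _]; rewrite -leq_divRL // ltnNge mi.
Qed.

Lemma definable_div a b : definable a -> definable b ->
  definable (fun x env => a x env %/ b x env).
Proof.
move=> da db.
have ds : definable (fun x env => \sum_(0 <= i < a x env) (i.+1 * b x env <= a x env)).
  apply: (definable_sum (g := fun x env i => nat_of_bool (i.+1 * b x env <= a x env))) => //.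
  apply: definable_leq; last exact: definable_shift.
  by apply: definable_mul (definable_succ (definable_var 0)) _; apply: definable_shift.
(* A quotient by 0 is 0 by convention, whereas the count would give the dividend. *)
apply: definable_ext (definable_if (definable_eqn db (definable_const 0)) (definable_const 0) ds) => x env.
by case: eqP => [->|/eqP]; rewrite ?divn0 // -lt0n => /divn_sum ->.
Qed.

Lemma definable_mod a b : definable a -> definable b ->
  definable (fun x env => a x env %% b x env).
Proof.
move=> da db.
apply: definable_ext (definable_sub da (definable_mul (definable_div da db) db)) => x env.
by rewrite {1}(divn_eq (a x env) (b x env)) addKn.
Qed.

(** An arbitrary [h], such as the transition table of a machine, becomes a chain of [K] comparisons
    with constants. *)
Lemma definable_table a (h : nat -> nat) K : definable a -> (forall x env, a x env < K) ->
  definable (fun x env => h (a x env)).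
Proof.
move=> da aK.
have : definable (fun x env => if a x env < K then h (a x env) else 0).
  elim: K {aK} => [|K IH]; first exact: (definable_const 0).
  apply: definable_ext (definable_if (definable_eqn da (definable_const K)) (definable_const (h K)) IH) => x env.
  by rewrite ltnS (leq_eqVlt (a x env) K); case: eqP => [->|_] /=; rewrite ?leqnn ?mul1n ?mul0n.
by apply: definable_ext => x env; rewrite aK.
Qed.

End Closure.

Ltac definability := cbv beta; first
  [ assumption
  | exact: definable_const
  | exact: definable_var
  | exact: definable_size
  | apply: definable_polybound; definability
  | apply: definable_exists; definability
  | apply: definable_forall; definability
  | apply: definable_add; definability
  | apply: definable_sub; definability
  | apply: definable_mul; definability
  | apply: definable_div; definability
  | apply: definable_mod; definability
  | apply: definable_succ; definability
  | apply: definable_bit; definability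
  | apply: definable_leq; definability
  | apply: definable_eqn; definability
  | apply: definable_eqb; definability
  | apply: definable_not; definability
  | apply: definable_and; definability
  | apply: definable_or; definability
  | apply: definable_ifb; definability
  | apply: definable_if; definability
  | apply: definable_sum; definability
  | idtac ].

(** * Encodings of bipartite graphs *)

(** The encoding bit by bit, as a function of the position, which is the form a definable output
    must have. The two unary headers with their separators occupy [n + m + 2] positions. *)
Definition encbit (n m : nat) (adj : nat -> nat -> bool) (i : nat) : bool :=
  if i < n then true else if i == n then false
  else if i < n.+1 + m then true else if i == n.+1 + m then false
  else adj ((i - (n + m + 2)) %/ m) ((i - (n + m + 2)) %% m).

Lemma flatten_matrix (n m : nat) (adj : nat -> nat -> bool) :
  flatten [seq [seq adj b c | c <- iota 0 m] | b <- iota 0 n] =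
  mkseq (fun r => adj (r %/ m) (r %% m)) (n * m).
Proof.
elim: n => [|n IH] //; rewrite -addn1 iotaD map_cat flatten_cat IH /= cats0 mulnDl mul1n.
rewrite /mkseq iotaD map_cat; congr cat; rewrite !add0n.
have -> : iota (n * m) m = [seq n * m + i | i <- iota 0 m] by rewrite -iotaDl addn0.
rewrite -map_comp; apply/eq_in_map => c.
rewrite mem_iota /= => cm; rewrite divnMDl ?modnMDl; last by lia.
by rewrite divn_small // modn_small // addn0.
Qed.

Lemma PBO_encodeE (n m : nat) (adj : nat -> nat -> bool) :
  PBO_encode (fun (b : 'I_n) (c : 'I_m) => adj b c) =
  mkseq (encbit n m adj) (n + m + 2 + n * m).
Proof.
rewrite /PBO_encode.
have -> : [seq [seq adj b c | c : 'I_m <- enum 'I_m] | b : 'I_n <- enum 'I_n] =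
          [seq [seq adj b c | c <- iota 0 m] | b <- iota 0 n].
  rewrite -[in RHS](val_enum_ord n) -map_comp; apply: eq_map => b /=.
  by rewrite -[in RHS](val_enum_ord m) -map_comp.
rewrite flatten_matrix.
apply: (@eq_from_nth _ false).
  by rewrite !size_cat !size_nseq /= !size_mkseq; lia.
rewrite !size_cat !size_nseq /= size_mkseq => i ilt.
rewrite nth_mkseq; last by lia.
rewrite /encbit nth_cat size_nseq; case: ltnP => [iN|Ni]; first by rewrite nth_nseq iN.
case: eqP => [->|ne]; first by rewrite subnn.
have -> : i - n = (i - n.+1).+1 by lia.
rewrite /= nth_cat size_nseq; have -> : (i - n.+1 < m) = (i < n.+1 + m) by lia.
case: ltnP => [im|mi]; first by rewrite nth_nseq; case: ifP => //; lia.
case: eqP => [->|ne']; first by have -> : n.+1 + m - n.+1 - m = 0 by lia.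
have -> : i - n.+1 - m = (i - (n + m + 2)).+1 by lia.
by rewrite /= nth_mkseq //; lia.
Qed.

Lemma PBO_encode_nat (n m : nat) (E : 'I_n -> 'I_m -> bool) :
  exists adj : nat -> nat -> bool, E = fun b c => adj b c.
Proof.
exists (fun b c => if insub b is Some b' then if insub c is Some c' then E b' c' else false else false).
by do 2! apply: functional_extensionality => ?; rewrite !valK.
Qed.

(** The first two zeros stand at [n] and [n.+1 + m]; a smaller second parameter would put a zero
    where the first encoding has a one. One-sided inequalities suffice, as the lemma is applied in
    both directions. *)
Lemma encbit_head n m adj n' m' adj' :
  (forall i, i < n + m + 2 -> i < n' + m' + 2 -> encbit n m adj i = encbit n' m' adj' i) ->
  n <= n' /\ (n = n' -> m <= m').
Proof.
move=> H; split=> [|nn]; rewrite leqNgt; apply/negP => lt.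
  have := H n'; rewrite /encbit lt ltnn eqxx; by move=> /(_ ltac:(lia) ltac:(lia)).
subst n'; have := H (n.+1 + m'); rewrite /encbit ltnn eqxx ltn_add2l lt.
rewrite !ifF; [|lia..]; by move=> /(_ ltac:(lia) ltac:(lia)).
Qed.

(** The language asks for some graph with the given encoding; injectivity is what recovers the
    constructed graph from a yes-instance. *)
Lemma PBO_encode_inj n m (adj : nat -> nat -> bool) n' m' (adj' : nat -> nat -> bool) :
  PBO_encode (fun (b : 'I_n) (c : 'I_m) => adj b c) =
  PBO_encode (fun (b : 'I_n') (c : 'I_m') => adj' b c) ->
  [/\ n = n', m = m' & forall b c, b < n -> c < m -> adj b c = adj' b c].
Proof.
rewrite !PBO_encodeE => e.
have es : n + m + 2 + n * m = n' + m' + 2 + n' * m'.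
  by have := congr1 size e; rewrite !size_mkseq.
have H i : i < n + m + 2 + n * m -> encbit n m adj i = encbit n' m' adj' i.
  by move=> il; have := congr1 (fun s => nth false s i) e; rewrite !nth_mkseq // -es.
have [n1 m1] : n <= n' /\ (n = n' -> m <= m').
  by apply: (@encbit_head _ _ adj _ _ adj') => i i1 _; apply: H; lia.
have [n2 m2] : n' <= n /\ (n' = n -> m' <= m).
  by apply: (@encbit_head _ _ adj' _ _ adj) => i _ i1; rewrite H //; lia.
have nn : n = n' by lia.
subst n'; have mm : m = m' by have := m1 erefl; have := m2 erefl; lia.
subst m'; split=> // b c bn cm.
have := H (n + m + 2 + (b * m + c)) ltac:(nia).
rewrite /encbit; do 4! (case: ifP => [|_]; first by lia).
rewrite addKn divnMDl ?modnMDl ?divn_small ?modn_small ?addn0 //; lia.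
Qed.

Lemma card_sum_ord n (p : nat -> bool) : #|[set b : 'I_n | p b]| = \sum_(0 <= b < n) p b.
Proof.
rewrite big_mkord -sum1dep_card big_mkcond /=.
by apply: eq_bigr => i _; case: (p i).
Qed.

Lemma PBO_yesP (n m : nat) (adj : nat -> nat -> bool) :
  PBO_yes (fun (b : 'I_n) (c : 'I_m) => adj b c) <->
  exists v : nat -> bool, forall c, c < m ->
    [/\ \sum_(0 <= b < n) adj b c <= 4,
        \sum_(0 <= b < n) (adj b c && v b) <= 2 &
        \sum_(0 <= b < n) (adj b c && ~~ v b) <= 2].
Proof.
split=> [[deg [BH [BV [disj cover H]]]]|[v H]].
  exists (fun b => if insub b is Some b' then b' \in BH else false) => c cm.
  have [H1 H2] := H (Ordinal cm); have H0 := deg (Ordinal cm).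
  rewrite -!card_sum_ord; split=> //.
  - apply: leq_trans H1; apply/subset_leq_card/subsetP => b.
    by rewrite !inE valK andbC.
  - apply: leq_trans H2; apply/subset_leq_card/subsetP => b.
    rewrite !inE valK => /andP[-> /negbTE bH]; rewrite andbT.
    by have := in_setT b; rewrite -cover inE bH.
split=> [c|]; first by have [] := H c (ltn_ord c); rewrite -card_sum_ord.
exists [set b : 'I_n | v b], [set b : 'I_n | ~~ v b]; split=> [||c].
- by apply/setP => b; rewrite !inE andbN.
- by apply/setP => b; rewrite !inE orbN.
have [_ H1 H2] := H c (ltn_ord c); rewrite -!card_sum_ord in H1 H2.
split; [apply: leq_trans H1 | apply: leq_trans H2];
  by apply/subset_leq_card/subsetP => b; rewrite !inE andbC.
Qed.

(** * Membership in NP *)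

Lemma pair_enc_nth (x w : seq bool) :
  [/\ size (pair_enc x w) = 2 * size x + 2 + size w,
      forall i, i < size x -> nth false (pair_enc x w) (2 * i) = nth false x i /\
                              nth false (pair_enc x w) (2 * i + 1) = nth false x i,
      nth false (pair_enc x w) (2 * size x) = false,
      nth false (pair_enc x w) (2 * size x + 1) = true &
      forall j, nth false (pair_enc x w) (2 * size x + 2 + j) = nth false w j].
Proof.
elim: x => [|b x [IH1 IH2 IH3 IH4 IH5]] //.
have E : pair_enc (b :: x) w = b :: b :: pair_enc x w by [].
have S : size (b :: x) = (size x).+1 by [].
rewrite E S; split=> [|[|i] ilt||| j].
- by rewrite /= IH1; lia.
- by [].
- have [e1 e2] := IH2 i ilt; have -> : 2 * i.+1 = (2 * i).+2 by lia.
  by split=> //; rewrite -e2.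
- by have -> : 2 * (size x).+1 = (2 * size x).+2 by lia.
- by have -> : 2 * (size x).+1 + 1 = (2 * size x + 1).+2 by lia.
- have -> : 2 * (size x).+1 + 2 + j = (2 * size x + 2 + j).+2 by lia.
  exact: IH5.
Qed.

(* For [z = pair_enc x w] and [l = size x], the even positions below [2 * l]
   spell [x], and [w] starts at position [2 * l + 2]. *)
Definition xbit (z : seq bool) (i : nat) : bool := nth false z (2 * i).

Definition check (z : seq bool) (l n m : nat) : bool :=
  all (fun i => nth false z (2 * i) == nth false z (2 * i + 1)) (iota 0 l) &&
  ~~ (nth false z (2 * l) == nth false z (2 * l + 1)) &&
  (l == n + m + 2 + n * m) &&
  all (fun i => xbit z i) (iota 0 n) && ~~ xbit z n &&
  all (fun i => xbit z (n.+1 + i)) (iota 0 m) && ~~ xbit z (n.+1 + m) &&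
  all (fun c =>
    (\sum_(0 <= b < n) xbit z (n + m + 2 + b * m + c) <= 4) &&
    (\sum_(0 <= b < n) (xbit z (n + m + 2 + b * m + c) && nth false z (2 * l + 2 + b)) <= 2) &&
    (\sum_(0 <= b < n) (xbit z (n + m + 2 + b * m + c) && ~~ nth false z (2 * l + 2 + b)) <= 2))
    (iota 0 m).

(** The length of the first component and the two sizes of the graph are searched for rather than
    parsed; all of them are below [size z], so bounded quantifiers do it. *)
Definition verifier (z : seq bool) : bool :=
  has (fun l => has (fun n => has (fun m => check z l n m) (iota 0 (size z)))
    (iota 0 (size z))) (iota 0 (size z)).

Lemma verifier_definable : definable (fun z _ => verifier z).
Proof. rewrite /verifier /check /xbit; definability. Qed.

(** The pairs of bits before position [2 * size x] are equal and the separator is not, so a check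
    can succeed only with [l = size x]. *)
Lemma verifierP x w : verifier (pair_enc x w) <->
  exists n m, check (pair_enc x w) (size x) n m.
Proof.
have [Hs H1 H2 H3 H4] := pair_enc_nth x w.
split=> [/hasP[l _ /hasP[n _ /hasP[m _ ck]]]|[n [m ck]]].
  exists n, m; suff <- : l = size x by [].
  move: ck; rewrite /check -!andbA => /and3P[/allP eql neql _].
  case: (ltngtP l (size x)) => // lx.
    by have [e1 e2] := H1 l lx; rewrite e1 e2 eqxx in neql.
  by have := eql (size x); rewrite mem_iota H2 H3 /= => /(_ lx).
have mem k : k <= size x -> k \in iota 0 (size (pair_enc x w)) by rewrite mem_iota Hs; lia.
have e : size x = n + m + 2 + n * m.
  by move: ck; rewrite /check -!andbA => /and4P[_ _ /eqP].
apply/hasP; exists (size x); first exact: mem.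
apply/hasP; exists n; first by apply: mem; lia.
by apply/hasP; exists m; first by apply: mem; lia.
Qed.

Lemma check_encode n m adj w (x := mkseq (encbit n m adj) (n + m + 2 + n * m)) :
  check (pair_enc x w) (size x) n m =
  all (fun c =>
    (\sum_(0 <= b < n) adj b c <= 4) &&
    (\sum_(0 <= b < n) (adj b c && nth false w b) <= 2) &&
    (\sum_(0 <= b < n) (adj b c && ~~ nth false w b) <= 2)) (iota 0 m).
Proof.
have [Hs H1 H2 H3 H4] := pair_enc_nth x w.
have sx : size x = n + m + 2 + n * m by rewrite size_mkseq.
have X i : i < n + m + 2 + n * m -> xbit (pair_enc x w) i = encbit n m adj i.
  by move=> il; rewrite /xbit; have [] := H1 i; rewrite ?sx // => -> _; rewrite nth_mkseq.
rewrite /check H2 H3 sx eqxx !X /=; [|lia..].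
have -> : all (fun i => nth false (pair_enc x w) (2 * i) == nth false (pair_enc x w) (2 * i + 1))
              (iota 0 (n + m + 2 + n * m)).
  by apply/allP => i; rewrite mem_iota /= => il; have [] := H1 i; rewrite ?sx // => -> ->.
have -> : all (fun i => xbit (pair_enc x w) i) (iota 0 n).
  by apply/allP => i; rewrite mem_iota /= => il; rewrite X; [rewrite /encbit il | lia].
have -> : all (fun i => xbit (pair_enc x w) (n.+1 + i)) (iota 0 m).
  apply/allP => i; rewrite mem_iota /= => il; rewrite X; last by lia.
  by rewrite /encbit; case: ifP => // _; case: eqP; [lia | move=> _; case: ifP => //; lia].
have -> : encbit n m adj n = false by rewrite /encbit ltnn eqxx.
have -> : encbit n m adj (n.+1 + m) = false.
  by rewrite /encbit ltnn eqxx; case: ifP => [|_]; [lia | case: eqP].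
rewrite /=; apply: eq_in_all => c; rewrite mem_iota /= => cm.
have A b : b < n -> xbit (pair_enc x w) (n + m + 2 + b * m + c) = adj b c.
  move=> bn; rewrite X; last by nia.
  rewrite /encbit; do 4! (case: ifP => [|_]; first by lia).
  have -> : n + m + 2 + b * m + c - (n + m + 2) = b * m + c by lia.
  by rewrite divnMDl ?modnMDl ?divn_small ?modn_small ?addn0 //; lia.
rewrite -sx; congr (_ && _ && _); congr (_ <= _);
  by apply: eq_big_nat => b /andP[_ bn]; rewrite A // H4.
Qed.

Lemma PBO_in_NP : in_NP PARTITION_BY_ORIENTATION.
Proof.
exists (fun z => verifier z), 1; split.
  exists (fun z => mkseq (fun i => verifier z != 0 :> nat) 1); split.
    exact: definable_poly_time (definable_const 1) verifier_definable.
  by move=> z; split; rewrite /mkseq /=; case: verifier.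
move=> x; split.
  move=> [n [m [E [-> yes]]]]; have [adj EE] := PBO_encode_nat E; subst E.
  have [v Hv] := (PBO_yesP n m adj).1 yes.
  exists (mkseq v n); rewrite PBO_encodeE size_mkseq; split.
    by rewrite size_mkseq /polybound; lia.
  apply/verifierP; exists n, m; rewrite check_encode.
  apply/allP => c; rewrite mem_iota /= => cm; have [h1 h2 h3] := Hv c cm.
  rewrite h1 /=; apply/andP; split; [move: h2 | move: h3]; apply: leq_trans; rewrite eq_leq //;
    by apply: eq_big_nat => b /andP[_ bn]; rewrite nth_mkseq.
move=> [w [_ /verifierP[n [m ck]]]].
(* The graph is read off [x] itself; the header and size checks then make [x] its encoding. *)
pose adj b c := nth false x (n + m + 2 + b * m + c).
have [Hs H1 H2 H3 H4] := pair_enc_nth x w.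
have X i : i < size x -> xbit (pair_enc x w) i = nth false x i by move=> /H1[].
have sx : size x = n + m + 2 + n * m.
  by move: ck; rewrite /check -!andbA => /and4P[_ _ /eqP].
have xE : x = mkseq (encbit n m adj) (n + m + 2 + n * m).
  move: (ck); rewrite /check -!andbA => /and4P[_ _ _ /and5P[/allP h1 h2 /allP h3 h4 _]].
  apply: (@eq_from_nth _ false) => [|i]; rewrite ?size_mkseq // sx => ilt.
  rewrite nth_mkseq // -X ?sx // /encbit.
  case: ifP => [iN|/negbT Ni]; first by apply: h1; rewrite mem_iota.
  case: eqP => [->|ne]; first exact: negbTE.
  case: ifP => [im|/negbT mi].
    have := h3 (i - n.+1); rewrite mem_iota; have -> : n.+1 + (i - n.+1) = i by lia.
    by apply; lia.
  case: eqP => [->|ne']; first exact: negbTE.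
  rewrite /adj X ?sx //; congr nth.
  by have := divn_eq (i - (n + m + 2)) m; lia.
exists n, m, (fun b c => adj b c); split; first by rewrite PBO_encodeE.
apply/PBO_yesP; exists (fun b => nth false w b) => c cm.
rewrite xE check_encode in ck.
by have := allP ck c; rewrite mem_iota -andbA => /(_ cm)/and3P[].
Qed.

(** * Numerical computation histories *)

Definition sym_code (a : sym) : nat := if a is Some b then nat_of_bool b else 2.

Definition sym_decode (s : nat) : sym :=
  match s with 0 => Some false | 1 => Some true | _ => None end.

Lemma sym_codeK : cancel sym_code sym_decode.
Proof. by case=> [[]|]. Qed.

Lemma sym_code_lt a : sym_code a < 3.
Proof. by case: a => [[]|]. Qed.

Definition move_code (m : move) : nat := match m with MoveL => 0 | Stay => 1 | MoveR => 2 end.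

Section Trace.
Variable M : TM.
Let Q := (tm_Q M).+1.

(* [k = 3 * q + s] codes the state [q] and the scanned symbol [s]; a halting
   machine is made to stand still. *)
Definition transition (k : nat) : nat * nat * nat :=
  if insub (k %/ 3) is Some q then
    if @tm_delta M q (sym_decode (k %% 3)) is Some (q', a, m)
    then (nat_of_ord q', sym_code a, move_code m) else (k %/ 3, k %% 3, 1)
  else (0, 0, 1).

Definition next_state k := (transition k).1.1.
Definition next_sym k := (transition k).1.2.
Definition next_move k := (transition k).2.

Lemma next_state_lt k : next_state k < Q.
Proof.
rewrite /next_state /transition; case: insubP => [q _ e|] //=.
by case: tm_delta => [[[q' a] m]|] /=; rewrite -?e ltn_ord.
Qed.

Lemma next_sym_lt k : next_sym k < 3.
Proof.
rewrite /next_sym /transition; case: insubP => [q _ e|] //=.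
by case: tm_delta => [[[q' a] m]|] //=; rewrite ?sym_code_lt ?ltn_mod.
Qed.

Lemma next_move_lt k : next_move k < 3.
Proof.
rewrite /next_move /transition; case: insubP => [q _ e|] //=.
by case: tm_delta => [[[q' a] []]|].
Qed.

Variables (S : nat) (z : seq bool).

Definition start_sym (p : nat) : nat :=
  if p < S then 2 else sym_code (nth None (map Some z) (p - S)).

(* state, head position, tape; positions are shifted by [S] *)
Definition nconf := (nat * nat * (nat -> nat))%type.

Definition nstep (c : nconf) : nconf :=
  let: (q, h, T) := c in let k := q * 3 + T h in
  (next_state k, h + next_move k - 1, fun p => if p == h then next_sym k else T p).

Definition history (t : nat) : nconf := iter t nstep (0, S, start_sym).
Definition hstate t := (history t).1.1.
Definition hhead t := (history t).1.2.
Definition htape t := (history t).2.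

Lemma history_step t (k := hstate t * 3 + htape t (hhead t)) :
  [/\ hstate t.+1 = next_state k, hhead t.+1 = hhead t + next_move k - 1 &
      forall p, htape t.+1 p = if p == hhead t then next_sym k else htape t p].
Proof.
rewrite /k /hstate /hhead /htape /history iterS.
by case: (iter t nstep _) => [[q h] T].
Qed.

Lemma htape_lt t p : htape t p < 3.
Proof.
elim: t p => [|t IH] p; first by rewrite /htape /= /start_sym; case: ifP => // _; apply: sym_code_lt.
by have [_ _ ->] := history_step t; case: ifP => // _; apply: next_sym_lt.
Qed.

Lemma hstate_lt t : hstate t < Q.
Proof. by case: t => [|t] //; have [-> _ _] := history_step t; apply: next_state_lt. Qed.

(** The head moves by at most one cell per step, so during the first [S] steps the truncated
    subtraction in [nstep] loses nothing. *)
Lemma hhead_bound t : t <= S -> S - t <= hhead t <= S + t.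
Proof.
elim: t => [|t IH] tS; first by rewrite subn0 addn0 /hhead /= leqnn.
have [_ -> _] := history_step t.
have := IH (ltnW tS); have := next_move_lt (hstate t * 3 + htape t (hhead t)); lia.
Qed.

Lemma history_correct t : t < S ->
  exists T h, [/\ represents (exec t (init M z)) T h,
    hstate t = cf_state (exec t (init M z)), Posz (hhead t) = (h + Posz S)%R &
    forall p, T (Posz p - Posz S)%R = sym_decode (htape t p)].
Proof.
elim: t => [|t IH] tS.
  exists (input_tape z), 0%R; split; [exact: init_represents | | by rewrite add0r |].
    by rewrite /hstate /=; case: (z).
  move=> p; rewrite /htape /= /start_sym; case: ltnP => pS.
    by have -> : (Posz p - Posz S)%R = Negz (S - p).-1 by lia.
  have -> : (Posz p - Posz S)%R = Posz (p - S) by lia.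
  by rewrite sym_codeK.
have [T [h [rep eq_q eq_h eq_T]]] := IH (ltnW tS).
have [-> -> Tn] := history_step t.
have bnd := hhead_bound (ltnW (ltnW tS)).
have -> : exec t.+1 (init M z) = exec 1 (exec t (init M z)) by rewrite -addn1 exec_add.
rewrite /=; set c := exec t _ in rep eq_q *.
have Th : T h = sym_decode (htape t (hhead t)).
  by rewrite -eq_T eq_h addrK.
set s := htape t (hhead t) in Th Tn *.
have s3 : s < 3 by apply: htape_lt.
have tr : transition (hstate t * 3 + s) =
    if tm_delta (cf_state c) (T h) is Some (q', a, m)
    then (nat_of_ord q', sym_code a, move_code m) else (hstate t, s, 1).
  rewrite /transition divnMDl // divn_small // addn0 modnMDl modn_small //.
  by rewrite {1}eq_q valK Th.
rewrite /next_state /next_move /next_sym tr in Tn *.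
case dl : (tm_delta (cf_state c) (T h)) Tn => [[[q' a] m]|] /= Tn; last first.
  rewrite (halted_represents rep dl); exists T, h; split=> //.
    by rewrite -eq_h; lia.
  by move=> p; rewrite Tn eq_T; case: eqP => // ->.
have [c' [-> eq' rep']] := step_represents rep dl.
exists (write T h a), (h + offset m)%R; split=> //.
- by rewrite eq'.
- by move: bnd; case: (m) => /=; lia.
- move=> p; rewrite Tn /write; have -> : ((Posz p - Posz S)%R == h) = (p == hhead t).
    by apply/eqP/eqP; lia.
  by case: eqP => [_|_]; rewrite ?sym_codeK.
Qed.

(** A halted machine stands still, so the answer found at [t'] is still under the head at any later
    [t] in range, which may be fixed in advance. *)
Lemma history_output (t t' : nat) b : t' <= t < S -> halted (exec t' (init M z)) ->
  output (exec t' (init M z)) = [:: b] -> htape t (hhead t) = b.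
Proof.
move=> /andP[t't tS] halt out.
have E : exec t (init M z) = exec t' (init M z).
  rewrite -(subnKC t't) exec_add; case: (t - t') => // j /=.
  by move: halt; rewrite /halted; case: step.
have [T [h [rep _ eq_h eq_T]]] := history_correct tS.
have cur : cf_cur (exec t (init M z)) = sym_decode (htape t (hhead t)).
  by have := rep 0%R; rewrite addr0 -eq_T eq_h addrK.
move: out cur; rewrite -E /output /=; case: cf_cur => [b'|] //= [-> _].
by have := htape_lt t (hhead t); case: (htape _ _) => [|[|[|]]] //= _ [->].
Qed.

End Trace.

(** * Triples with not-all-equal labels *)

Definition nae (a b c : bool) : bool := ~~ ((a == b) && (b == c)).

Definition in_triple (u v w b : nat) : bool := (b == u) || (b == v) || (b == w).

Lemma sum_count n (p : nat -> bool) : \sum_(0 <= b < n) p b = count p (iota 0 n).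
Proof.
rewrite -sum1_count [RHS]big_mkcond /= /index_iota subn0.
by apply: eq_bigr => b _; case: (p b).
Qed.

Lemma count_iota_le n (p : nat -> bool) (s : seq nat) :
  (forall b, p b -> b \in s) -> count p (iota 0 n) <= size s.
Proof.
move=> H; rewrite -size_filter; apply: uniq_leq_size; first by rewrite filter_uniq ?iota_uniq.
by move=> b; rewrite mem_filter => /andP[/H].
Qed.

Lemma nae_counts n u v w (l : nat -> bool) : nae (l u) (l v) (l w) ->
  [/\ \sum_(0 <= b < n) in_triple u v w b <= 4,
      \sum_(0 <= b < n) (in_triple u v w b && l b) <= 2 &
      \sum_(0 <= b < n) (in_triple u v w b && ~~ l b) <= 2].
Proof.
move=> H; rewrite !sum_count; split.
- apply: (@leq_trans 3) => //; apply: (@count_iota_le _ _ [:: u; v; w]) => b.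
  by rewrite !inE orbA.
(* In each of the six cases the list consists of the vertices labelled true, a single one being
   repeated. *)
- move: H; rewrite /nae; case lu: (l u); case lv: (l v); case lw: (l w) => //= _;
  [ apply: (@count_iota_le _ _ [:: u; v]) | apply: (@count_iota_le _ _ [:: u; w])
  | apply: (@count_iota_le _ _ [:: u; u]) | apply: (@count_iota_le _ _ [:: v; w])
  | apply: (@count_iota_le _ _ [:: v; v]) | apply: (@count_iota_le _ _ [:: w; w])] => b;
  rewrite /in_triple !inE => /andP[/orP[/orP[]|] /eqP ->]; rewrite ?lu ?lv ?lw ?eqxx ?orbT //.
- move: H; rewrite /nae; case lu: (l u); case lv: (l v); case lw: (l w) => //= _;
  [ apply: (@count_iota_le _ _ [:: w; w]) | apply: (@count_iota_le _ _ [:: v; v])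
  | apply: (@count_iota_le _ _ [:: v; w]) | apply: (@count_iota_le _ _ [:: u; u])
  | apply: (@count_iota_le _ _ [:: u; w]) | apply: (@count_iota_le _ _ [:: u; v])] => b;
  rewrite /in_triple !inE => /andP[/orP[/orP[]|] /eqP ->]; rewrite ?lu ?lv ?lw ?eqxx ?orbT //.
Qed.

(** Distinctness and the bound [n] make the three vertices contribute three to a sum, so a constant
    triple would violate one of the two bounds. *)
Lemma counts_nae n u v w (l : nat -> bool) :
  uniq [:: u; v; w] -> all (gtn n) [:: u; v; w] ->
  \sum_(0 <= b < n) (in_triple u v w b && l b) <= 2 ->
  \sum_(0 <= b < n) (in_triple u v w b && ~~ l b) <= 2 -> nae (l u) (l v) (l w).
Proof.
move=> uni lt3; rewrite !sum_count => H1 H2.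
have big (p : nat -> bool) : p u -> p v -> p w -> count (fun b => in_triple u v w b && p b) (iota 0 n) > 2.
  move=> pu pv pw; rewrite -size_filter; apply: (@uniq_leq_size _ [:: u; v; w]) => // b.
  move: lt3; rewrite /= andbT => /and3P[un vn wn].
  by rewrite mem_filter mem_iota /in_triple !inE => /or3P[] /eqP ->; rewrite eqxx ?orbT /= ?pu ?pv ?pw.
apply/negP => /andP[/eqP uv /eqP vw]; case lu: (l u); move: uv vw; rewrite lu => uv vw.
  by have := big l lu (esym uv) (etrans (esym vw) (esym uv)); rewrite ltnNge H1.
have := big (fun b => ~~ l b); rewrite ltnNge H2 lu -uv -vw -uv => H.
by have := H isT isT isT.
Qed.

Section Reduction.
Variables (M : TM) (kw kV : nat).

(** * The reduction *)

(** Large enough for the states as well as for the three symbols, so that head atoms and cell atoms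
    share one radix. *)
Definition arity : nat := tm_Q M + 4.

Definition wlen (x : seq bool) : nat := polybound kw (size x).
Definition inlen (x : seq bool) : nat := 2 * size x + 2 + wlen x.
(** [inlen x] is the length of the longest pair the verifier may have to read, so by [time x] it has
    halted on every admissible witness. With [origin x] one larger, the head stays strictly inside
    [width x] cells up to that time. *)
Definition time (x : seq bool) : nat := (polybound kV (inlen x)).+1.
Definition origin (x : seq bool) : nat := (time x).+1.
Definition width (x : seq bool) : nat := 2 * origin x + inlen x.
Definition wpos (x : seq bool) (i : nat) : nat := origin x + (2 * size x + 2) + i.
Definition nrules (x : seq bool) : nat := 8 * (time x * width x * width x * arity * 3).
Definition nverts (x : seq bool) : nat :=
  8 * ((time x).+2 * width x * arity + nrules x + 8).
Definition ntriples (x : seq bool) : nat := 12 * nrules x.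

(* Vertices: [vH t p q] says that at time [t] the head is at position [p] in
   state [q], [vC t p s] that the cell [p] then holds [s]; [vU i] and [vV i]
   say that the [i]-th witness cell is not blank, resp. not 0. *)
Definition vert (tag y : nat) : nat := 8 * y + tag.
Definition vH x t p q := vert 0 ((t * width x + p) * arity + q).
Definition vC x t p s := vert 1 ((t * width x + p) * arity + s).
Definition vU i := vert 2 i.
Definition vV i := vert 3 i.
Definition vaux j := vert 4 j.
Definition vspec i := vert 5 i.
Notation vF := (vspec 0).
Notation vT1 := (vspec 4).
Notation vT2 := (vspec 5).
Notation vBot := (vspec 6).

Definition jtag (j : nat) : nat := j %% 8.
Definition jsym (j : nat) : nat := j %/ 8 %% 3.
Definition jstate (j : nat) : nat := j %/ 8 %/ 3 %% arity.
Definition jhead (x : seq bool) (j : nat) : nat := j %/ 8 %/ 3 %/ arity %% width x.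
Definition jpos (x : seq bool) (j : nat) : nat := j %/ 8 %/ 3 %/ arity %/ width x %% width x.
Definition jtime (x : seq bool) (j : nat) : nat := j %/ 8 %/ 3 %/ arity %/ width x %/ width x.
Definition jkey (j : nat) : nat := jstate j * 3 + jsym j.

Definition rule (x : seq bool) (tag t p h q s : nat) : nat :=
  8 * ((((t * width x + p) * width x + h) * arity + q) * 3 + s) + tag.

(** The division by 2 undoes the doubling of bits in [pair_enc]. In the last range but one the
    difference is 0 and then 1, which is the separator. *)
Definition input_sym (x : seq bool) (p : nat) : nat :=
  if p < origin x then 2
  else if p < origin x + 2 * size x then nat_of_bool (nth false x ((p - origin x) %/ 2))
  else if p < wpos x 0 then p - origin x - 2 * size x else 2.

(** Meaning of the tags: 0, the next content of a cell, kept or written; 1, the next state and head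
    position; 2, a scanned 0 at the last moment is rejection; 3, the initial head; 4, the initial
    cells outside the witness; 5, a witness cell neither blank nor 0 holds 1; 6, a blank witness
    cell is followed by a blank. The remaining tag, and positions that do not fit the tag, give a
    trivial rule. *)
Definition ruleA (x : seq bool) (j : nat) : nat :=
  if jtag j == 0 then vH x (jtime x j) (jhead x j) (jstate j)
  else if jtag j == 1 then vH x (jtime x j) (jpos x j) (jstate j)
  else if jtag j == 2 then vH x (time x) (jpos x j) (jstate j)
  else if jtag j == 5 then if jpos x j < wlen x then vU (jpos x j) else vT1
  else if jtag j == 6 then if jpos x j < wlen x then vC x 0 (wpos x (jpos x j)) 2 else vT1
  else vT1.

Definition ruleB (x : seq bool) (j : nat) : nat :=
  if jtag j == 0 then vC x (jtime x j) (jpos x j) (jsym j)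
  else if jtag j == 1 then vC x (jtime x j) (jpos x j) (jsym j)
  else if jtag j == 2 then vC x (time x) (jpos x j) 0
  else if jtag j == 5 then if jpos x j < wlen x then vV (jpos x j) else vT2
  else vT2.

Definition ruleD (x : seq bool) (j : nat) : nat :=
  if jtag j == 0 then
    vC x (jtime x j).+1 (jpos x j) (if jpos x j == jhead x j then next_sym M (jkey j) else jsym j)
  else if jtag j == 1 then
    vH x (jtime x j).+1 (jpos x j + next_move M (jkey j) - 1) (next_state M (jkey j))
  else if jtag j == 2 then vBot
  else if jtag j == 3 then vH x 0 (origin x) 0
  else if jtag j == 4 then
    if (wpos x 0 <= jpos x j) && (jpos x j < wpos x (wlen x)) then vT1
    else vC x 0 (jpos x j) (input_sym x (jpos x j))
  else if jtag j == 5 then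
    if jpos x j < wlen x then vC x 0 (wpos x (jpos x j)) 1 else vT1
  else if jtag j == 6 then
    if jpos x j < wlen x then vC x 0 (wpos x (jpos x j).+1) 2 else vT1
  else vT1.

(* With [vF] labelled false, the triples of kinds 0 and 1 say that [ruleA] and
   [ruleB] imply [ruleD], those of kinds 2 and 3 that a cell is blank or [vU],
   resp. holds 0 or [vV]; the others make [vT1] and [vT2] true and [vBot]
   false. *)
Definition tri1 (x : seq bool) (c : nat) : nat :=
  if c %% 12 == 0 then ruleA x (c %/ 12)
  else if c %% 12 == 1 then vaux (c %/ 12)
  else if c %% 12 == 2 then if c %/ 12 < wlen x then vU (c %/ 12) else vspec 1
  else if c %% 12 == 3 then if c %/ 12 < wlen x then vV (c %/ 12) else vspec 1
  else if c %% 12 < 10 then vspec (4 + (c %% 12 - 4) %/ 3)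
  else if c %% 12 == 10 then vBot
  else vspec 1.

Definition tri2 (x : seq bool) (c : nat) : nat :=
  if c %% 12 == 0 then ruleB x (c %/ 12)
  else if c %% 12 == 1 then ruleD x (c %/ 12)
  else if c %% 12 == 2 then if c %/ 12 < wlen x then vC x 0 (wpos x (c %/ 12)) 2 else vspec 2
  else if c %% 12 == 3 then if c %/ 12 < wlen x then vC x 0 (wpos x (c %/ 12)) 0 else vspec 2
  else if c %% 12 < 10 then vF
  else if c %% 12 == 10 then vT1
  else vspec 2.

Definition tri3 (x : seq bool) (c : nat) : nat :=
  if c %% 12 == 0 then vaux (c %/ 12)
  else if c %% 12 == 1 then vF
  else if c %% 12 == 2 then if c %/ 12 < wlen x then vF else vspec 3
  else if c %% 12 == 3 then if c %/ 12 < wlen x then vF else vspec 3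
  else if c %% 12 < 10 then vspec (1 + (c %% 12 - 4) %% 3)
  else if c %% 12 == 10 then vT2
  else vspec 3.

Definition adj (x : seq bool) (b c : nat) : bool :=
  in_triple (tri1 x c) (tri2 x c) (tri3 x c) b.

Definition reduction (x : seq bool) : seq bool :=
  PBO_encode (fun (b : 'I_(nverts x)) (c : 'I_(ntriples x)) => adj x b c).

(** * Ranges of the codes and distinctness within triples *)

Lemma radix_div y d r : r < d -> (y * d + r) %/ d = y.
Proof. by move=> rd; rewrite divnMDl ?divn_small ?addn0 //; lia. Qed.

Lemma radix_mod y d r : r < d -> (y * d + r) %% d = r.
Proof. by move=> rd; rewrite modnMDl modn_small. Qed.

Lemma radix_lt y m d r : y < m -> r < d -> y * d + r < m * d.
Proof. by nia. Qed.

Lemma arity_gt3 : 3 < arity.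
Proof. by rewrite /arity; lia. Qed.

Lemma state_lt_arity q : q < (tm_Q M).+1 -> q < arity.
Proof. by rewrite /arity; lia. Qed.

Lemma width_gt0 x : 0 < width x.
Proof. by rewrite /width /origin; lia. Qed.

Lemma vertE tag tag' y y' : tag < 8 -> tag' < 8 ->
  (vert tag y == vert tag' y') = (tag == tag') && (y == y').
Proof. by move=> t8 t8'; rewrite /vert; apply/eqP/andP => [e|[/eqP -> /eqP ->] //]; split; apply/eqP; lia. Qed.

Lemma rule_decode x tag t p h q s (j := rule x tag t p h q s) :
  tag < 8 -> p < width x -> h < width x -> q < arity -> s < 3 ->
  [/\ jtag j = tag, jsym j = s, jstate j = q, jhead x j = h &
      jpos x j = p /\ jtime x j = t].
Proof.
move=> tag8 pW hW qA s3; rewrite /jtag /jsym /jstate /jhead /jpos /jtime /j /rule.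
by rewrite [8 * _]mulnC !(radix_div, radix_mod).
Qed.

Lemma rule_lt x tag t p h q s : tag < 8 -> t < time x -> p < width x -> h < width x ->
  q < arity -> s < 3 -> rule x tag t p h q s < nrules x.
Proof.
move=> tag8 tT pW hW qA s3; rewrite /rule /nrules ![8 * _]mulnC.
by do 5! apply: radix_lt => //.
Qed.

Lemma jpos_lt x j : jpos x j < width x.
Proof. by rewrite ltn_mod width_gt0. Qed.

Lemma jhead_lt x j : jhead x j < width x.
Proof. by rewrite ltn_mod width_gt0. Qed.

Lemma jstate_lt j : jstate j < arity.
Proof. by rewrite ltn_mod; have := arity_gt3; lia. Qed.

Lemma jsym_lt j : jsym j < 3.
Proof. by rewrite ltn_mod. Qed.

Lemma jtime_lt x j : j < nrules x -> jtime x j < time x.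
Proof.
have := width_gt0 x; have := arity_gt3 => A3 W0.
by rewrite /jtime /nrules !ltn_divLR // 1?mulnC //; lia.
Qed.

Lemma payload_lt x t p a : t <= time x -> p <= width x -> a < arity ->
  (t * width x + p) * arity + a < (time x).+2 * width x * arity.
Proof.
move=> tT pW aA; apply: radix_lt => //.
by have := width_gt0 x; nia.
Qed.

Lemma vert_lt x tag y : tag < 8 ->
  y < (time x).+2 * width x * arity + nrules x + 8 -> vert tag y < nverts x.
Proof. by rewrite /vert /nverts; lia. Qed.

Lemma vH_lt x t p a : t <= time x -> p <= width x -> a < arity -> vH x t p a < nverts x.
Proof. by move=> tT pW aA; apply: vert_lt => //; have := payload_lt tT pW aA; lia. Qed.

Lemma vC_lt x t p a : t <= time x -> p <= width x -> a < arity -> vC x t p a < nverts x.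
Proof. by move=> tT pW aA; apply: vert_lt => //; have := payload_lt tT pW aA; lia. Qed.

Lemma vspec_lt x i : i < 8 -> vspec i < nverts x.
Proof. by move=> i8; apply: vert_lt => //; lia. Qed.

Lemma wlen_le_width x : wlen x <= width x.
Proof. by rewrite /width /inlen; lia. Qed.

Lemma wpos_le_width x i : i <= wlen x -> wpos x i < width x.
Proof. by rewrite /wpos /width /inlen /origin; lia. Qed.

Lemma width_le_nrules x : width x <= nrules x.
Proof.
rewrite /nrules; have := arity_gt3; have := width_gt0 x; have : 0 < time x by [].
move: (time x) (width x) arity => t W A t0 W0 A3.
have h1 : 1 <= t * W by rewrite muln_gt0 t0.
have h2 : W <= t * W * W by rewrite leq_pmull.
have h3 : t * W * W <= t * W * W * A by rewrite leq_pmulr //; lia.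
lia.
Qed.

Lemma vU_lt x i : i < wlen x -> vU i < nverts x.
Proof. by move=> iw; apply: vert_lt => //; have := width_le_nrules x; have := wlen_le_width x; lia. Qed.

Lemma vV_lt x i : i < wlen x -> vV i < nverts x.
Proof. by move=> iw; apply: vert_lt => //; have := width_le_nrules x; have := wlen_le_width x; lia. Qed.

Lemma sym_lt_arity s : s < 3 -> s < arity.
Proof. by have := arity_gt3; lia. Qed.

Lemma wcell_lt x i s : i <= wlen x -> s < 3 -> vC x 0 (wpos x i) s < nverts x.
Proof. by move=> iw s3; apply: vC_lt (sym_lt_arity s3) => //; apply: ltnW; apply: wpos_le_width. Qed.

Lemma ruleA_lt x j : j < nrules x -> ruleA x j < nverts x.
Proof.
move=> /jtime_lt/ltnW jt; have jh := ltnW (jhead_lt x j); have jp := ltnW (jpos_lt x j).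
have jq := jstate_lt j; rewrite /ruleA; do ! case: ifP => //; move=> *.
all: by [apply: vspec_lt | apply: vH_lt | apply: vU_lt | apply: wcell_lt => //; apply: ltnW].
Qed.

Lemma input_sym_lt x p : input_sym x p < 3.
Proof.
rewrite /input_sym; do ! case: ifP => //; first by case: nth.
by rewrite /wpos; lia.
Qed.

Lemma ruleB_lt x j : j < nrules x -> ruleB x j < nverts x.
Proof.
move=> /jtime_lt/ltnW jt; have jp := ltnW (jpos_lt x j).
have js := sym_lt_arity (jsym_lt j); have A0 : 0 < arity by have := arity_gt3; lia.
rewrite /ruleB; do ! case: ifP => //; move=> *.
all: by [apply: vspec_lt | apply: vC_lt | apply: vV_lt].
Qed.

Lemma ruleD_lt x j : j < nrules x -> ruleD x j < nverts x.
Proof.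
move=> /jtime_lt jt; have jp := jpos_lt x j; have jp' := ltnW jp.
have js := sym_lt_arity (jsym_lt j); have A0 : 0 < arity by have := arity_gt3; lia.
have ns := sym_lt_arity (next_sym_lt M (jkey j)).
have nq := state_lt_arity (next_state_lt M (jkey j)).
have nd := next_move_lt M (jkey j).
have oW : origin x <= width x by rewrite /width; lia.
have is_ := sym_lt_arity (input_sym_lt x (jpos x j)).
rewrite /ruleD; do ! case: ifP => //; move=> *.
all: try by [apply: vspec_lt | apply: vC_lt | apply: vH_lt | apply: wcell_lt => //; apply: ltnW].
by apply: vH_lt => //; lia.
Qed.

(** Mostly the tags differ. Premises that are lacking are filled in by [vT1] on one side and by
    [vT2] on the other, which keeps them distinct. *)
Lemma tri_uniq x c : uniq [:: tri1 x c; tri2 x c; tri3 x c].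
Proof.
have neq3 (u v w : nat) : u != v -> u != w -> v != w -> uniq [:: u; v; w].
  by move=> uv uw vw; rewrite /= !inE negb_or uv uw vw.
apply: neq3; rewrite /tri1 /tri2 /tri3 /ruleA /ruleB /ruleD /vH /vC /vU /vV /vaux /vspec.
all: do ! case: ifP => //.
all: move=> *.
all: rewrite vertE //=.
all: lia.
Qed.

Lemma tri_lt x c : c < ntriples x -> all (gtn (nverts x)) [:: tri1 x c; tri2 x c; tri3 x c].
Proof.
rewrite /ntriples mulnC -ltn_divLR // => jlt.
have lw : vaux (c %/ 12) < nverts x by apply: vert_lt => //; lia.
have := ruleA_lt jlt; have := ruleB_lt jlt; have := ruleD_lt jlt => hD hB hA.
have hC a : c %/ 12 < wlen x -> a < 3 -> vC x 0 (wpos x (c %/ 12)) a < nverts x.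
  move=> cw a3; apply: vC_lt => //; last exact: sym_lt_arity.
  by apply: ltnW; apply: wpos_le_width; apply: ltnW.
rewrite /= andbT; apply/and3P; split; rewrite /tri1 /tri2 /tri3.
all: do ! case: ifP => //.
all: move=> *.
all: try by [apply: vspec_lt; lia | apply: vU_lt | apply: vV_lt | apply: hC].
Qed.

Lemma PBO_yes_reduction x :
  PBO_yes (fun (b : 'I_(nverts x)) (c : 'I_(ntriples x)) => adj x b c) <->
  exists l : nat -> bool, forall c, c < ntriples x -> nae (l (tri1 x c)) (l (tri2 x c)) (l (tri3 x c)).
Proof.
split=> [/PBO_yesP[l H]|[l H]].
  exists l => c clt; have [_ H1 H2] := H c clt.
  exact: counts_nae (tri_uniq x c) (tri_lt clt) H1 H2.
by apply/PBO_yesP; exists l => c clt; apply: nae_counts (H c clt).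
Qed.

(** * The initial tape *)

Lemma start_sym_code (z : seq bool) (S p : nat) : S <= p ->
  start_sym S z p = if p - S < size z then nat_of_bool (nth false z (p - S)) else 2.
Proof.
move=> Sp; rewrite /start_sym ltnNge Sp /=; case: ltnP => pz.
  by rewrite (nth_map false).
by rewrite nth_default // size_map.
Qed.

Lemma start_sym_input x w p : size w <= wlen x ->
  (p < wpos x 0) || (wpos x (wlen x) <= p) ->
  start_sym (origin x) (pair_enc x w) p = input_sym x p.
Proof.
move=> wl hp; have [Hs H1 H2 H3 H4] := pair_enc_nth x w.
rewrite /input_sym; case: ltnP => pS; first by rewrite /start_sym pS.
rewrite start_sym_code // Hs.
have := @divn_eq (p - origin x) 2; set i := _ %/ 2; set r := _ %% 2 => pE.
have r2 : r < 2 by rewrite ltn_mod.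
case: (ltnP p (origin x + 2 * size x)) => [plt|pge].
  rewrite ifT; last by lia.
  have [e0 e1] := H1 i ltac:(lia).
  have [->|->] : p - origin x = 2 * i \/ p - origin x = 2 * i + 1 by lia.
    by rewrite e0.
  by rewrite e1.
case: (ltnP p (wpos x 0)) => [plt'|pge'].
  rewrite /wpos addn0 in plt'; rewrite ifT; last by lia.
  have [e|e] : p - origin x = 2 * size x \/ p - origin x = 2 * size x + 1 by lia.
    by rewrite e H2; lia.
  by rewrite e H3; lia.
by rewrite ifF // ltnNge; rewrite /wpos in hp pge'; lia.
Qed.

Lemma start_sym_witness x w i :
  start_sym (origin x) (pair_enc x w) (wpos x i) = if i < size w then nat_of_bool (nth false w i) else 2.
Proof.
have [Hs _ _ _ H4] := pair_enc_nth x w.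
rewrite start_sym_code; last by rewrite /wpos; lia.
have -> : wpos x i - origin x = 2 * size x + 2 + i by rewrite /wpos; lia.
by rewrite Hs H4 ltn_add2l.
Qed.

Lemma nrules_gt0 x : 0 < nrules x.
Proof. by have := width_le_nrules x; have := width_gt0 x; lia. Qed.

Definition final_sym (x w : seq bool) : nat :=
  htape M (origin x) (pair_enc x w) (time x) (hhead M (origin x) (pair_enc x w) (time x)).

(** * From a labelling to an accepted witness *)

Section Sound.
Variables (x : seq bool) (l : nat -> bool).
Hypothesis Hl : forall c, c < ntriples x -> nae (l (tri1 x c)) (l (tri2 x c)) (l (tri3 x c)).
Hypothesis lF : l vF = false.

Let triple k j : k < 12 -> j < nrules x -> [/\ 12 * j + k < ntriples x, (12 * j + k) %% 12 = k & (12 * j + k) %/ 12 = j].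
Proof. by move=> k12 jn; rewrite /ntriples; split; lia. Qed.

(** If [vspec i] had the label of [vF], its three triples with [vF] would make [vspec 1], [vspec 2]
    and [vspec 3] all true, contradicting the triple formed by these. *)
Let l_true i : i = 4 \/ i = 5 -> l (vspec i).
Proof.
move=> hi; apply/negPn/negP => /negbTE li.
have A k : k < 3 -> l (vspec (1 + k)).
  move=> k3; have [] := @triple (4 + (i - 4) * 3 + k) 0 ltac:(lia) (nrules_gt0 x).
  move=> /Hl; rewrite /tri1 /tri2 /tri3 => H e1 _; move: H; rewrite e1.
  have -> : (4 + (i - 4) * 3 + k - 4) %/ 3 = i - 4 by lia.
  have -> : (4 + (i - 4) * 3 + k - 4) %% 3 = k by lia.
  have -> : 4 + (i - 4) = i by lia.
  do 4! (case: eqP => [|_]; first by lia).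
  case: ifP => [_|]; last by lia.
  by rewrite /nae li lF /=; case: (l _).
have [] := @triple 11 0 isT (nrules_gt0 x).
move=> /Hl; rewrite /tri1 /tri2 /tri3 => H e1 _; move: H; rewrite e1 /=.
by rewrite (A 0) // (A 1) // (A 2).
Qed.

Let l_bot : l vBot = false.
Proof.
have [] := @triple 10 0 isT (nrules_gt0 x).
move=> /Hl; rewrite /tri1 /tri2 /tri3 => H e1 _; move: H; rewrite e1 /=.
by rewrite (l_true (or_introl erefl)) (l_true (or_intror erefl)); case: (l _).
Qed.

Let horn j : j < nrules x -> l (ruleA x j) -> l (ruleB x j) -> l (ruleD x j).
Proof.
move=> jn hA hB.
have [c0 e0 e0'] := @triple 0 j isT jn; have := Hl c0.
have [c1 e1 e1'] := @triple 1 j isT jn; have := Hl c1.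
rewrite /tri1 /tri2 /tri3 e0 e0' e1 e1' /= /nae hA hB lF.
by case: (l (vaux j)); case: (l (ruleD x j)).
Qed.

Let choice_U i : i < wlen x -> l (vU i) || l (vC x 0 (wpos x i) 2).
Proof.
move=> iw; have jn : i < nrules x by have := width_le_nrules x; have := wlen_le_width x; lia.
have [c0 e0 e0'] := @triple 2 i isT jn; have := Hl c0.
rewrite /tri1 /tri2 /tri3 e0 e0' /= iw /nae lF.
by case: (l (vU i)); case: (l (vC _ _ _ _)).
Qed.

Let choice_V i : i < wlen x -> l (vV i) || l (vC x 0 (wpos x i) 0).
Proof.
move=> iw; have jn : i < nrules x by have := width_le_nrules x; have := wlen_le_width x; lia.
have [c0 e0 e0'] := @triple 3 i isT jn; have := Hl c0.
rewrite /tri1 /tri2 /tri3 e0 e0' /= iw /nae lF.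
by case: (l (vV i)); case: (l (vC _ _ _ _)).
Qed.

Let horn_rule tag t p h q s (j := rule x tag t p h q s) :
  tag < 8 -> t < time x -> p < width x -> h < width x -> q < arity -> s < 3 ->
  l (ruleA x j) -> l (ruleB x j) -> l (ruleD x j).
Proof. by move=> *; apply: horn => //; apply: rule_lt. Qed.

Let A0 : 0 < arity. Proof. by have := arity_gt3; lia. Qed.
Let W0 := width_gt0 x.

Let T1 : l vT1. Proof. by apply: l_true; left. Qed.
Let T2 : l vT2. Proof. by apply: l_true; right. Qed.

Let fixed_cell p : p < width x -> (p < wpos x 0) || (wpos x (wlen x) <= p) ->
  l (vC x 0 p (input_sym x p)).
Proof.
move=> pW hp; have [e1 e2 e3 e4 [e5 e6]] := @rule_decode x 4 0 p 0 0 0 isT pW W0 A0 isT.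
have := @horn_rule 4 0 p 0 0 0 isT isT pW W0 A0 isT.
rewrite /ruleA /ruleB /ruleD e1 e5 /= T1 T2 ifF; first by apply.
by apply/negbTE; rewrite negb_and -ltnNge -leqNgt.
Qed.

(** Several symbols may be labelled true in one witness cell, and any choice among the true ones is
    good as long as it spells a word. The word is cut at the first true blank; before it, 0 is taken
    wherever it is true. *)
Let blanks : nat := find (fun i => l (vC x 0 (wpos x i) 2)) (iota 0 (wlen x)).
Let w : seq bool := mkseq (fun i => ~~ l (vC x 0 (wpos x i) 0)) blanks.

Let size_w : size w <= wlen x.
Proof. by rewrite size_mkseq -[X in _ <= X](size_iota 0) find_size. Qed.

Let blank_tail i : blanks <= i -> i < wlen x -> l (vC x 0 (wpos x i) 2).
Proof.
elim: i => [|i IH] bi iw.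
  have b0 : blanks = 0 by lia.
  have : has (fun i => l (vC x 0 (wpos x i) 2)) (iota 0 (wlen x)).
    by rewrite has_find -/blanks size_iota b0.
  by move=> /(nth_find 0); rewrite -/blanks b0 nth_iota.
move: bi; rewrite leq_eqVlt => /orP[/eqP bi|bi].
  have : has (fun i => l (vC x 0 (wpos x i) 2)) (iota 0 (wlen x)).
    by rewrite has_find -/blanks size_iota bi.
  by move=> /(nth_find 0); rewrite -/blanks bi nth_iota.
have iw' := ltnW iw; have iW := leq_trans iw' (wlen_le_width x).
have [e1 e2 e3 e4 [e5 e6]] := @rule_decode x 6 0 i 0 0 0 isT iW W0 A0 isT.
have := @horn_rule 6 0 i 0 0 0 isT isT iW W0 A0 isT.
by rewrite /ruleA /ruleB /ruleD e1 e5 /= iw' T2; apply => //; apply: IH.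
Qed.

Let start_cell p : p < width x -> l (vC x 0 p (start_sym (origin x) (pair_enc x w) p)).
Proof.
move=> pW; case hp : ((p < wpos x 0) || (wpos x (wlen x) <= p)).
  by rewrite start_sym_input //; apply: fixed_cell.
have [i iw ->] : exists2 i, i < wlen x & p = wpos x i.
  by exists (p - wpos x 0); rewrite /wpos in hp *; lia.
rewrite start_sym_witness size_mkseq; case: ltnP => ib; last exact: blank_tail.
rewrite nth_mkseq //.
case C0 : (l (vC x 0 (wpos x i) 0)) => //=.
have C2 : l (vC x 0 (wpos x i) 2) = false.
  by have := before_find 0 ib; rewrite nth_iota.
(* With neither blank nor 0 true, both disjunctions yield their other member, and the rule of tag 5
   turns these into the symbol 1. *)
have := choice_U iw; have := choice_V iw; rewrite C0 C2 !orbF => hV hU.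
have iW := leq_trans iw (wlen_le_width x).
have [e1 e2 e3 e4 [e5 e6]] := @rule_decode x 5 0 i 0 0 0 isT iW W0 A0 isT.
have := @horn_rule 5 0 i 0 0 0 isT isT iW W0 A0 isT.
by rewrite /ruleA /ruleB /ruleD e1 e5 /= iw; apply.
Qed.

Let z := pair_enc x w.
Let hh := hhead M (origin x) z.
Let hs := hstate M (origin x) z.
Let ht := htape M (origin x) z.

Let hh_lt t : t <= time x -> hh t < width x.
Proof.
move=> tT; have := @hhead_bound M (origin x) z t; rewrite /hh /origin /width /origin; lia.
Qed.

Let true_history t : t <= time x ->
  l (vH x t (hh t) (hs t)) /\ forall p, p < width x -> l (vC x t p (ht t p)).
Proof.
elim: t => [|t IH] tT.
  split; last exact: start_cell.
  have [e1 e2 e3 e4 [e5 e6]] := @rule_decode x 3 0 0 0 0 0 isT W0 W0 A0 isT.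
  have := @horn_rule 3 0 0 0 0 0 isT isT W0 W0 A0 isT.
  by rewrite /ruleA /ruleB /ruleD e1 /= T1 T2; apply.
have [hH hC] := IH (ltnW tT).
have [eS eH eT] := history_step M (origin x) z t.
have hW := hh_lt (ltnW tT); have qA := state_lt_arity (hstate_lt M (origin x) z t).
split=> [|p pW].
  have s3 := htape_lt M (origin x) z t (hh t).
  have [e1 e2 e3 e4 [e5 e6]] := @rule_decode x 1 t (hh t) 0 (hs t) (ht t (hh t)) isT hW W0 qA s3.
  have := @horn_rule 1 t (hh t) 0 (hs t) (ht t (hh t)) isT tT hW W0 qA s3.
  rewrite /ruleA /ruleB /ruleD /jkey e1 e2 e3 e5 e6 /= => /(_ hH (hC _ hW)).
  by rewrite /hh /hs eS eH.
have s3 := htape_lt M (origin x) z t p.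
have [e1 e2 e3 e4 [e5 e6]] := @rule_decode x 0 t p (hh t) (hs t) (ht t p) isT pW hW qA s3.
have := @horn_rule 0 t p (hh t) (hs t) (ht t p) isT tT pW hW qA s3.
rewrite /ruleA /ruleB /ruleD /jkey e1 e2 e3 e4 e5 e6 /= => /(_ hH (hC _ pW)).
rewrite /ht eT -/hh -/ht; by case: eqP => // ->.
Qed.

Lemma reduction_sound : exists2 w', size w' <= wlen x & final_sym x w' != 0.
Proof.
exists w => //; apply/eqP => fin.
have [hH hC] := true_history (leqnn _).
have hW := hh_lt (leqnn _); have qA := state_lt_arity (hstate_lt M (origin x) z (time x)).
have [e1 e2 e3 e4 [e5 e6]] := @rule_decode x 2 0 (hh (time x)) 0 (hs (time x)) 0 isT hW W0 qA isT.
have := @horn_rule 2 0 (hh (time x)) 0 (hs (time x)) 0 isT isT hW W0 qA isT.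
rewrite /ruleA /ruleB /ruleD e1 e3 e5 /= l_bot => /(_ hH) H.
by have := hC _ hW; rewrite -[ht _ _]/(final_sym x w) fin => /H.
Qed.
End Sound.

(** * From an accepted witness to a labelling *)

Section Complete.
Variables (x w : seq bool).
Hypothesis size_w : size w <= wlen x.
Hypothesis fin : final_sym x w != 0.

Let z := pair_enc x w.
Let hh := hhead M (origin x) z.
Let hs := hstate M (origin x) z.
Let ht := htape M (origin x) z.

(** Atoms are true exactly as in the computation on [w]. Among the special vertices [vspec 1] is
    true besides [vT1] and [vT2], so that the triple of [vspec 1], [vspec 2], [vspec 3] is not
    constant. *)
Let truth (b : nat) : bool :=
  let y := b %/ 8 in
  let t := y %/ arity %/ width x in
  let p := y %/ arity %% width x in
  match b %% 8 with
  | 0 => (hh t == p) && (hs t == y %% arity)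
  | 1 => ht t p == y %% arity
  | 2 => ht 0 (wpos x y) != 2
  | 3 => ht 0 (wpos x y) != 0
  | 5 => y \in [:: 1; 4; 5]
  | _ => false
  end.

(** The auxiliary vertex of a rule is the negated conjunction of its premises: it always differs
    from one of them, and it is false only if the conclusion has to be true. *)
Let label (b : nat) : bool :=
  if b %% 8 == 4 then ~~ (truth (ruleA x (b %/ 8)) && truth (ruleB x (b %/ 8))) else truth b.

Let vert_tag tag y : tag < 8 -> vert tag y %% 8 = tag.
Proof. by move=> t8; rewrite /vert; lia. Qed.

Let vert_payload tag y : tag < 8 -> vert tag y %/ 8 = y.
Proof. by move=> t8; rewrite /vert; lia. Qed.

Let truth_H t p a : p < width x -> a < arity -> truth (vH x t p a) = (hh t == p) && (hs t == a).
Proof. by move=> pW aA; rewrite /truth /vH vert_tag // vert_payload // !(radix_div, radix_mod). Qed.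

Let truth_C t p a : p < width x -> a < arity -> truth (vC x t p a) = (ht t p == a).
Proof. by move=> pW aA; rewrite /truth /vC vert_tag // vert_payload // !(radix_div, radix_mod). Qed.

Let truth_U i : truth (vU i) = (ht 0 (wpos x i) != 2).
Proof. by rewrite /truth /vU vert_tag // vert_payload. Qed.

Let truth_V i : truth (vV i) = (ht 0 (wpos x i) != 0).
Proof. by rewrite /truth /vV vert_tag // vert_payload. Qed.

Let truth_spec i : truth (vspec i) = (i \in [:: 1; 4; 5]).
Proof. by rewrite /truth /vspec vert_tag // vert_payload. Qed.

Let label_vert tag y : tag < 8 -> tag != 4 -> label (vert tag y) = truth (vert tag y).
Proof. by move=> t8 t4; rewrite /label vert_tag // (negbTE t4). Qed.

Let label_aux j : label (vaux j) = ~~ (truth (ruleA x j) && truth (ruleB x j)).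
Proof. by rewrite /label /vaux vert_tag // vert_payload. Qed.

Let label_rules j : [/\ label (ruleA x j) = truth (ruleA x j),
  label (ruleB x j) = truth (ruleB x j) & label (ruleD x j) = truth (ruleD x j)].
Proof.
by split; rewrite /ruleA /ruleB /ruleD; do ! case: ifP => _; apply: label_vert.
Qed.

Let rule_true j : j < nrules x -> truth (ruleA x j) -> truth (ruleB x j) -> truth (ruleD x j).
Proof.
move=> /jtime_lt tT; have pW := jpos_lt x j; have hW := jhead_lt x j.
have qA := jstate_lt j; have s3 := jsym_lt j; have sA := sym_lt_arity s3.
have nsA := sym_lt_arity (next_sym_lt M (jkey j)).
have nq := state_lt_arity (next_state_lt M (jkey j)).
have A3 := arity_gt3.
have [eS eH eT] := history_step M (origin x) z (jtime x j).
rewrite /ruleA /ruleB /ruleD; case: eqP => [_|_].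
  rewrite truth_H // !truth_C //; last by case: ifP.
  move=> /andP[/eqP h_eq /eqP q_eq] /eqP s_eq; rewrite /ht eT -/ht -/hh -/hs h_eq q_eq.
  by case: (eqVneq (jpos x j) (jhead x j)) => [p_eq|_]; rewrite ?s_eq // -p_eq s_eq.
case: eqP => [_|_].
  rewrite truth_H // truth_C // => /andP[/eqP h_eq /eqP q_eq] /eqP s_eq.
  (* The actual head stays inside the width, so a rule whose premises hold never concludes with a
     code that spills over. *)
  have hb := @hhead_bound M (origin x) z (jtime x j).+1.
  rewrite -/hh -/hs -/ht in eS eH; rewrite h_eq q_eq s_eq -/(jkey j) in eS eH.
  rewrite truth_H //; first by rewrite eS eH !eqxx.
  by move: hb; rewrite -/hh eH /width /origin; lia.
case: eqP => [_|_].
  rewrite truth_H // truth_C //; last by lia.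
  move=> /andP[/eqP h_eq _] /eqP s_eq; move: fin.
  by rewrite /final_sym -/z -/hh -/ht h_eq s_eq.
case: (jtag j =P 3) => [->|_] /=.
  by move=> _ _; rewrite truth_H ?eqxx //; rewrite /width /origin; lia.
case: (jtag j =P 4) => [->|_] /=.
  case: ifP => // hp _ _; rewrite truth_C //; last exact/sym_lt_arity/input_sym_lt.
  apply/eqP; apply: start_sym_input => //.
  by move: hp; lia.
case: (jtag j =P 5) => [_|_].
  case: ifP => // iw; rewrite truth_U truth_V truth_C //; last by lia.
    have := htape_lt M (origin x) z 0 (wpos x (jpos x j)); rewrite -/ht.
    by case: (ht _ _) => [|[|[|]]].
  by apply: wpos_le_width; apply: ltnW.
case: eqP => // _; case: ifP => // iw; rewrite !truth_C //; try lia.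
- rewrite /ht /htape /= !start_sym_witness => /eqP H _.
  move: H; case: ltnP => [_|wi _]; first by case: nth.
  by rewrite ltnNge leqW.
- exact: wpos_le_width.
- by apply: wpos_le_width; apply: ltnW.
Qed.

Lemma reduction_complete : exists l : nat -> bool, forall c, c < ntriples x ->
  nae (l (tri1 x c)) (l (tri2 x c)) (l (tri3 x c)).
Proof.
exists label => c; rewrite /ntriples mulnC -ltn_divLR // => jlt.
have [lA lB lD] := label_rules (c %/ 12).
have spec i : label (vspec i) = (i \in [:: 1; 4; 5]) by rewrite label_vert // -truth_spec.
have cell a : a < 3 -> c %/ 12 < wlen x ->
    label (vC x 0 (wpos x (c %/ 12)) a) = (ht 0 (wpos x (c %/ 12)) == a).
  move=> a3 cw; rewrite label_vert // truth_C //; last exact: sym_lt_arity.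
  by apply: wpos_le_width; apply: ltnW.
rewrite /tri1 /tri2 /tri3; case: eqP => [_|_].
  rewrite lA lB label_aux; by case: (truth _); case: (truth _).
case: eqP => [_|_].
  rewrite label_aux lD spec /=; have := rule_true jlt.
  by case: (truth (ruleA _ _)); case: (truth (ruleB _ _)); case: (truth (ruleD _ _)) => // /(_ isT isT).
case: eqP => [_|_].
  case: ifP => cw; last by rewrite !spec.
  by rewrite cell // spec label_vert // truth_U; case: eqP.
case: eqP => [_|_].
  case: ifP => cw; last by rewrite !spec.
  by rewrite cell // spec label_vert // truth_V; case: eqP.
case: ltnP => [k10|k10].
  rewrite !spec; have : 4 + (c %% 12 - 4) %/ 3 = 4 \/ 4 + (c %% 12 - 4) %/ 3 = 5 by lia.
  by case=> ->; rewrite !inE /=.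
by case: eqP => _; rewrite !spec.
Qed.
End Complete.

Theorem reductionP x : PARTITION_BY_ORIENTATION (reduction x) <->
  exists2 w, size w <= wlen x & final_sym x w != 0.
Proof.
split=> [[n [m [E [e yes]]]]|[w wl fin]]; last first.
  exists (nverts x), (ntriples x), (fun b c => adj x b c); split=> //.
  by apply/PBO_yes_reduction; apply: reduction_complete fin.
have [adj' EE] := PBO_encode_nat E; subst E.
have [en em eadj] := PBO_encode_inj e; subst n m.
have yes' : PBO_yes (fun (b : 'I_(nverts x)) (c : 'I_(ntriples x)) => adj x b c).
  by move: yes; congr PBO_yes; do 2! apply: functional_extensionality => ?; rewrite eadj.
have [l Hl] := (PBO_yes_reduction x).1 yes'.
case lF : (l vF); last exact: reduction_sound Hl lF.
(* Not-all-equal is invariant under complement, and complementing makes [vF] false. *)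
apply: (@reduction_sound x (fun b => ~~ l b)); last by rewrite lF.
by move=> c /Hl; rewrite /nae; case: (l _); case: (l _); case: (l _).
Qed.

(** * The reduction is polynomial-time computable *)

Section Definability.

Let d_wlen : definable (fun x _ => wlen x).
Proof. rewrite /wlen; definability. Qed.
Let d_time : definable (fun x _ => time x).
Proof. rewrite /time /inlen; definability. Qed.
Let d_width : definable (fun x _ => width x).
Proof. rewrite /width /origin /inlen; definability. Qed.
#[local] Opaque width time wlen.

Let d_jtime a : definable a -> definable (fun x env => jtime x (a x env)).
Proof. move=> da; rewrite /jtime; definability. Qed.
Let d_jpos a : definable a -> definable (fun x env => jpos x (a x env)).
Proof. move=> da; rewrite /jpos; definability. Qed.
Let d_jhead a : definable a -> definable (fun x env => jhead x (a x env)).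
Proof. move=> da; rewrite /jhead; definability. Qed.
(** The transitions of the machine enter the reduction only through functions of the key, which is
    below the constant [arity * 3] and can be tabulated. *)
Let d_key (f : nat -> nat) a : definable a -> definable (fun x env => f (jkey (a x env))).
Proof.
move=> da; apply: (@definable_table (fun x env => jkey (a x env)) f (arity * 3)).
  rewrite /jkey /jstate /jsym; definability.
move=> x env; rewrite /jkey /jsym /jstate.
have : a x env %/ 8 %/ 3 %% arity < arity by rewrite ltn_mod /arity; lia.
by have : a x env %/ 8 %% 3 < 3; [rewrite ltn_mod | nia].
Qed.

Let d_ruleA a : definable a -> definable (fun x env => ruleA x (a x env)).
Proof.
move=> da; have := d_jtime da; have := d_jpos da; have := d_jhead da => dh dp dt.
rewrite /ruleA /vH /vC /vert /wpos /origin /jtag /jstate; definability.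
Qed.

Let d_ruleB a : definable a -> definable (fun x env => ruleB x (a x env)).
Proof.
move=> da; have := d_jtime da; have := d_jpos da => dp dt.
rewrite /ruleB /vH /vC /vert /wpos /origin /jtag /jsym; definability.
Qed.

Let d_ruleD a : definable a -> definable (fun x env => ruleD x (a x env)).
Proof.
move=> da; have := d_jtime da; have := d_jpos da; have := d_jhead da => dh dp dt.
have := d_key (next_sym M) da; have := d_key (next_move M) da; have := d_key (next_state M) da.
move=> ds dm dc; rewrite /ruleD /vH /vC /vert /input_sym /wpos /origin /jtag /jsym; definability.
Qed.

Lemma reduction_poly_time : poly_time_computable reduction.
Proof.
have d_nrules : definable (fun x _ => nrules x) by rewrite /nrules; definability.
have d_nverts : definable (fun x _ => nverts x) by rewrite /nverts; definability.
have d_ntriples : definable (fun x _ => ntriples x) by rewrite /ntriples; definability.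
have d_tri1 : forall a, definable a -> definable (fun x env => tri1 x (a x env)).
  move=> a da; have d12 := definable_div da (definable_const 12); have dA := d_ruleA d12.
  rewrite /tri1 /vaux /vU /vV /vspec /vert; definability.
have d_tri2 : forall a, definable a -> definable (fun x env => tri2 x (a x env)).
  move=> a da; have d12 := definable_div da (definable_const 12); have dB := d_ruleB d12; have dD := d_ruleD d12.
  rewrite /tri2 /vaux /vC /vspec /vert /wpos /origin; definability.
have d_tri3 : forall a, definable a -> definable (fun x env => tri3 x (a x env)).
  move=> a da; rewrite /tri3 /vaux /vspec /vert; definability.
have d_bit : definable (fun x env => encbit (nverts x) (ntriples x) (adj x) (env 0)).
  rewrite /encbit /adj /in_triple.
  pose c := fun (x : seq bool) (env : nat -> nat) => (env 0 - (nverts x + ntriples x + 2)) %% ntriples x.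
  have dc : definable c by rewrite /c; definability.
  have := d_tri1 _ dc; have := d_tri2 _ dc; have := d_tri3 _ dc; rewrite /c => d3 d2 d1.
  definability.
have := definable_poly_time (len := fun x _ => nverts x + ntriples x + 2 + nverts x * ntriples x) _ d_bit.
have -> : (fun x => mkseq (fun i => encbit (nverts x) (ntriples x) (adj x) (scons i env0 0) != 0 :> nat)
   (nverts x + ntriples x + 2 + nverts x * ntriples x)) = reduction.
  apply: functional_extensionality => x; rewrite /reduction PBO_encodeE.
  by apply: eq_mkseq => i /=; case: encbit.
apply; definability.
Qed.

End Definability.

End Reduction.

(** * NP-hardness *)

Lemma leq_polybound k m n : m <= n -> polybound k m <= polybound k n.
Proof.
move=> mn; rewrite /polybound leq_add2r leq_mul2l.
by case: k => [|k] //; rewrite leq_exp2r // mn orbT.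
Qed.

Lemma PBO_NP_hard : NP_hard PARTITION_BY_ORIENTATION.
Proof.
move=> L [V [kw [[f [[M [kV HM]] Hf]] HL]]].
exists (reduction M kw kV); split; first exact: reduction_poly_time.
have decide x w b : size w <= wlen kw x -> f (pair_enc x w) = [:: b] -> final_sym M kw kV x w = b.
  move=> wl fz; have [t [tT [halt out]]] := HM (pair_enc x w).
  apply: (history_output (t' := t) _ halt); last by rewrite out.
  rewrite ltnSn andbT ltnW // ltnS; apply: leq_trans tT _; apply: leq_polybound.
  by have [-> _ _ _ _] := pair_enc_nth x w; rewrite leq_add2l.
move=> x; rewrite HL reductionP; split=> [[w [wl Vz]]|[w wl fin]]; exists w => //.
  by rewrite (decide _ _ true) //; apply (Hf _).1.
(* [V] is an arbitrary predicate, so membership is obtained classically: outside [V] the decider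
   answers false and the final symbol would be 0. *)
split=> //; apply: NNPP => nV; move: fin.
by rewrite (decide _ _ false) //; apply (Hf _).2.
Qed.

Theorem theorem5 : NP_complete PARTITION_BY_ORIENTATION.
Proof. exact: conj PBO_in_NP PBO_NP_hard. Qed.
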